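(* Suppose $(G,H,t,\alpha)$ is a crossed module with $G$ and $H$ finite and let $\mathcal{G}$ be its associated strict $2$-group. The category $\mathrm{Rep}_{\mathcal{G}}(L)$ is a right $r$-category. Its tensor product and dualising functor are defined by the assignments $$M\otimes N=(M\otimes_{\Bbbk L}N^{\overline{\alpha}(p^{-1})})\in\mathrm{Rep}_{\mathcal{G}}(L)_{pq},\qquad D(M)=(M^{\overline{\alpha}(p)})^*\in\mathrm{Rep}_{\mathcal{G}}(L)_{p^{-1}}$$ for $p,q\in Q$ and $M\in\mathrm{Rep}_{\mathcal{G}}(L)_p$, $N\in\mathrm{Rep}_{\mathcal{G}}(L)_q$.
   Context: Fix a field $\Bbbk$. A crossed module $(G,H,t,\alpha)$ consists of groups $G,H$ and homomorphisms $t\colon H\to G$, $\alpha\colon G\to\mathrm{Aut}(H)$ with $t(\alpha(g)h)=g\,t(h)g^{-1}$ and $\alpha(t(l))h=lhl^{-1}$ for all $g\in G$, $h,l\in H$. Its associated strict $2$-group $\mathcal{G}$ is the strict monoidal groupoid with object set $G$, $\mathcal{G}(g,g')=\{(h,g)\in H\times G\mid t(h)g=g'\}$, composition $(h',t(h)g)\circ(h,g)=(h'h,g)$ and tensor product $(h,g)\otimes(h',g')=(h\,\alpha(g)h',gg')$. Put $K=\operatorname{im}t$ (normal in $G$), $L=\ker t$ (central in $H$), $Q=G/K$, and let $\overline{\alpha}\colon Q\to\mathrm{Aut}(L)$ be the homomorphism with $\overline{\alpha}([g])l=\alpha(g)l$. $\mathrm{Rep}(L)$ is the category of finite-dimensional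 $\Bbbk$-representations of $L$, and $\mathrm{Rep}_{\mathcal{G}}(L)=\bigoplus_{q\in Q}\mathrm{Rep}(L)_q$ with $\mathrm{Rep}(L)_q=\mathrm{Rep}(L)$; $\mathrm{Rep}_{\mathcal{G}}(L)_q$ denotes the homogeneous component of degree $q$. It is equivalent to the category of functors from $\mathcal{G}$ to finite-dimensional vector spaces. For $M\in\mathrm{Rep}(L)$ and $q\in Q$, $M^{\overline{\alpha}(q)}$ is the vector space $M$ with action $l\blacktriangleright m=(\overline{\alpha}(q)l)\triangleright m$. Since $L$ is abelian, $\Bbbk L$ is commutative; $\otimes_{\Bbbk L}$ is the tensor product of $\Bbbk L$-modules with its usual $\Bbbk L$-action ($l\cdot(m\otimes n)=(lm)\otimes n$), and $(-)^*$ is the linear dual with the transposed action $(l\varphi)(m)=\varphi(l\cdot m)$. A right $r$-category is a monoidal category $\mathcal{D}$ with unit $1$ such that for every $x$ there is $D_rx$ with $\mathcal{D}(x\otimes-,1)\cong\mathcal{D}(-,D_rx)$ and the induced functor $D_r\colon\mathcal{D}^{\mathrm{op}}\to\mathcal{D}$ (the right dualising functor) is an equivalence. *)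

(* Defs.v *)
From HB Require Import structures.
From Stdlib Require Import FunctionalExtensionality.
From mathcomp Require Import all_boot all_order all_fingroup all_algebra.

Set Implicit Arguments.
Unset Strict Implicit.
Unset Printing Implicit Defensive.

Import GRing.Theory VectorInternalTheory.

Declare Scope cat_scope.
Delimit Scope cat_scope with C.
Local Open Scope cat_scope.

Record category := Category {
  obj :> Type;
  hom : obj -> obj -> Type;
  idm : forall x, hom x x;
  cmp : forall x y z, hom y z -> hom x y -> hom x z;
  cmp1m : forall x y (f : hom x y), cmp (idm y) f = f;
  cmpm1 : forall x y (f : hom x y), cmp f (idm x) = f;
  cmpA : forall x y z w (h : hom z w) (g : hom y z) (f : hom x y),
    cmp h (cmp g f) = cmp (cmp h g) f }.

Arguments idm {c} x : rename.
Arguments cmp {c x y z} g f : rename.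

Notation "g ∘ f" := (cmp g f) (at level 40, left associativity) : cat_scope.

Definition is_iso (C : category) (x y : C) (f : hom x y) : Prop :=
  exists g : hom y x, g ∘ f = idm x /\ f ∘ g = idm y.

Definition op_cat (C : category) : category :=
  @Category C (fun x y => hom y x) (fun x => idm x)
    (fun x y z g f => f ∘ g)
    (fun x y f => cmpm1 f) (fun x y f => cmp1m f)
    (fun x y z w h g f => esym (cmpA f g h)).

Section ProductCategory.
Variables C D : category.

Definition prod_hom (x y : C * D) : Type := hom x.1 y.1 * hom x.2 y.2.

Fact prod_cmp1m (x y : C * D) (f : prod_hom x y) :
  (idm y.1 ∘ f.1, idm y.2 ∘ f.2) = f.
Proof. by case: f => f1 f2; rewrite !cmp1m. Qed.

Fact prod_cmpm1 (x y : C * D) (f : prod_hom x y) :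
  (f.1 ∘ idm x.1, f.2 ∘ idm x.2) = f.
Proof. by case: f => f1 f2; rewrite !cmpm1. Qed.

Fact prod_cmpA (x y z w : C * D)
    (h : prod_hom z w) (g : prod_hom y z) (f : prod_hom x y) :
  (h.1 ∘ (g.1 ∘ f.1), h.2 ∘ (g.2 ∘ f.2))
    = (h.1 ∘ g.1 ∘ f.1, h.2 ∘ g.2 ∘ f.2).
Proof. by rewrite !cmpA. Qed.

Definition prod_cat : category :=
  @Category (C * D) prod_hom (fun x => (idm x.1, idm x.2))
    (fun x y z g f => (g.1 ∘ f.1, g.2 ∘ f.2))
    prod_cmp1m prod_cmpm1 prod_cmpA.

End ProductCategory.

Record functor (C D : category) := Functor {
  fobj :> C -> D;
  fmap : forall x y, hom x y -> hom (fobj x) (fobj y);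
  fmap1 : forall x, fmap (idm x) = idm (fobj x);
  fmapM : forall x y z (g : hom y z) (f : hom x y),
    fmap (g ∘ f) = fmap g ∘ fmap f }.

Arguments fmap {C D} F {x y} f : rename.

Definition id_functor (C : category) : functor C C :=
  @Functor C C (fun x => x) (fun x y f => f) (fun x => erefl)
    (fun x y z g f => erefl).

Section FunctorConstructions.

Fact comp_fmap1 (C D E : category) (G : functor D E) (F : functor C D) x :
  fmap G (fmap F (idm x)) = idm (G (F x)).
Proof. by rewrite !fmap1. Qed.

Fact comp_fmapM (C D E : category) (G : functor D E) (F : functor C D)
    (x y z : C) (g : hom y z) (f : hom x y) :
  fmap G (fmap F (g ∘ f)) = fmap G (fmap F g) ∘ fmap G (fmap F f).
Proof. by rewrite !fmapM. Qed.

Definition comp_functor (C D E : category) (G : functor D E) (F : functor C D) :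
    functor C E :=
  @Functor C E (fun x => G (F x)) (fun x y f => fmap G (fmap F f))
    (comp_fmap1 G F) (comp_fmapM G F).

Definition op_functor (C D : category) (F : functor C D) :
    functor (op_cat C) (op_cat D) :=
  @Functor (op_cat C) (op_cat D) F (fun x y f => fmap F f)
    (fun x => fmap1 F x) (fun x y z g f => fmapM F f g).

Variables (C D C' D' : category) (F : functor C C') (G : functor D D').

Let pobj (x : prod_cat C D) : prod_cat C' D' := (F x.1, G x.2).
Let pmap (x y : prod_cat C D) (f : hom x y) : hom (pobj x) (pobj y) :=
  (fmap F f.1, fmap G f.2).

Fact prod_fmap1 x : pmap (idm x) = idm (pobj x).
Proof. by rewrite /pmap /= !fmap1. Qed.

Fact prod_fmapM x y z (g : hom y z) (f : hom x y) :
  pmap (g ∘ f) = pmap g ∘ pmap f.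
Proof. by rewrite /pmap /= !fmapM. Qed.

Definition prod_functor : functor (prod_cat C D) (prod_cat C' D') :=
  Functor prod_fmap1 prod_fmapM.

End FunctorConstructions.

Definition nat_isomorphic (C D : category) (F G : functor C D) : Prop :=
  exists eta : forall x, hom (F x) (G x),
    (forall x, is_iso (eta x)) /\
    (forall x y (f : hom x y), eta y ∘ fmap F f = fmap G f ∘ eta x).

Definition is_equivalence (C D : category) (F : functor C D) : Prop :=
  exists G : functor D C,
    nat_isomorphic (comp_functor G F) (id_functor C) /\
    nat_isomorphic (comp_functor F G) (id_functor D).

Definition tens (C : category) (T : functor (prod_cat C C) C) (x y : C) : C :=
  T (x, y).

Definition tensm (C : category) (T : functor (prod_cat C C) C) (x x' y y' : C)
    (f : hom x x') (g : hom y y') : hom (tens T x y) (tens T x' y') :=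
  @fmap (prod_cat C C) C T (x, y) (x', y') (f, g).

Arguments tensm {C} T {x x' y y'} f g.

Record monoidal (C : category) := Monoidal {
  tensor : functor (prod_cat C C) C;
  unit_obj : C;
  assoc : forall x y z,
    hom (tens tensor (tens tensor x y) z) (tens tensor x (tens tensor y z));
  lunit : forall x, hom (tens tensor unit_obj x) x;
  runit : forall x, hom (tens tensor x unit_obj) x;
  assoc_iso : forall x y z, is_iso (assoc x y z);
  lunit_iso : forall x, is_iso (lunit x);
  runit_iso : forall x, is_iso (runit x);
  assoc_nat : forall x x' y y' z z'
      (f : hom x x') (g : hom y y') (h : hom z z'),
    assoc x' y' z' ∘ tensm tensor (tensm tensor f g) h
      = tensm tensor f (tensm tensor g h) ∘ assoc x y z;
  lunit_nat : forall x x' (f : hom x x'),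
    lunit x' ∘ tensm tensor (idm unit_obj) f = f ∘ lunit x;
  runit_nat : forall x x' (f : hom x x'),
    runit x' ∘ tensm tensor f (idm unit_obj) = f ∘ runit x;
  pentagon : forall x y z w,
    assoc x y (tens tensor z w) ∘ assoc (tens tensor x y) z w
      = tensm tensor (idm x) (assoc y z w) ∘ assoc x (tens tensor y z) w
          ∘ tensm tensor (assoc x y z) (idm w);
  triangle : forall x y,
    tensm tensor (idm x) (lunit y) ∘ assoc x unit_obj y
      = tensm tensor (runit x) (idm y) }.

(* [theta x] is the representation C(x ⊗ -, 1) ≅ C(-, D x); naturality in [x]
   says that the action of [D] on morphisms is the one induced by the
   representing objects. *)
Definition is_right_dualising (C : category) (M : monoidal C)
    (D : functor (op_cat C) C) : Prop :=
  exists theta : forall x y : C,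
      hom (tens (tensor M) x y) (unit_obj M) -> hom y (D x),
    [/\ forall x y, bijective (theta x y),
        forall x y y' (f : hom y' y) (h : hom (tens (tensor M) x y) (unit_obj M)),
          theta x y' (h ∘ tensm (tensor M) (idm x) f) = theta x y h ∘ f
      & forall x x' y (f : hom x' x) (h : hom (tens (tensor M) x y) (unit_obj M)),
          theta x' y (h ∘ tensm (tensor M) f (idm y))
            = @fmap (op_cat C) C D x x' f ∘ theta x y h].

Record right_r_structure (C : category) := RightRStructure {
  rr_monoidal :> monoidal C;
  rr_dual : functor (op_cat C) C;
  rr_dualP : is_right_dualising rr_monoidal rr_dual;
  rr_dual_equiv : is_equivalence rr_dual }.

Local Open Scope ring_scope.

Section Rep.
Variables (k : fieldType) (L : finGroupType).

Record rep := Rep {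
  rep_space :> vectType k;
  rep_act : L -> 'End(rep_space);
  rep_act1 : rep_act 1%g = \1%VF;
  rep_actM : forall l l', rep_act (l * l')%g = (rep_act l \o rep_act l')%VF }.

Lemma rep_act1E (M : rep) m : rep_act M 1%g m = m.
Proof. by rewrite rep_act1 id_lfunE. Qed.

Lemma rep_actME (M : rep) l l' m :
  rep_act M (l * l')%g m = rep_act M l (rep_act M l' m).
Proof. by rewrite rep_actM comp_lfunE. Qed.

Definition equivariant (M N : rep) : {pred 'Hom(M, N)} :=
  fun f => [forall l, (f \o rep_act M l == rep_act N l \o f)%VF].

Arguments equivariant : clear implicits.

Lemma equivariantP (M N : rep) (f : 'Hom(M, N)) :
  reflect (forall l m, f (rep_act M l m) = rep_act N l (f m))
          (f \in equivariant M N).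
Proof.
apply: (iffP forallP) => fE l.
  by move=> m; rewrite -comp_lfunE (eqP (fE l)) comp_lfunE.
by apply/eqP/lfunP => m; rewrite !comp_lfunE.
Qed.

Fact equivariant_submod_closed (M N : rep) : submod_closed (equivariant M N).
Proof.
split=> [|a f g /equivariantP fE /equivariantP gE]; apply/equivariantP => l m.
  by rewrite !zero_lfunE linear0.
by rewrite !add_lfunE !scale_lfunE fE gE linearD linearZ.
Qed.

HB.instance Definition _ (M N : rep) :=
  GRing.isSubmodClosed.Build k 'Hom(M, N) (equivariant M N)
    (equivariant_submod_closed M N).

Record rep_hom (M N : rep) := RepHom {
  rep_hom_val :> 'Hom(M, N);
  _ : rep_hom_val \in equivariant M N }.

HB.instance Definition _ (M N : rep) := [isSub for @rep_hom_val M N].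
HB.instance Definition _ (M N : rep) := [Choice of rep_hom M N by <:].
HB.instance Definition _ (M N : rep) :=
  [SubChoice_isSubZmodule of rep_hom M N by <:].
HB.instance Definition _ (M N : rep) :=
  [SubZmodule_isSubLmodule of rep_hom M N by <:].

Lemma rep_homE (M N : rep) (f : rep_hom M N) l m :
  f (rep_act M l m) = rep_act N l (f m).
Proof. exact/equivariantP/valP. Qed.

Lemma rep_homP (M N : rep) (f g : rep_hom M N) : f =1 g <-> f = g.
Proof. by split=> [/lfunP/val_inj|->]. Qed.

Fact rep_id_subproof (M : rep) : \1%VF \in equivariant M M.
Proof. by apply/equivariantP => l m; rewrite !id_lfunE. Qed.

Definition rep_id (M : rep) : rep_hom M M := RepHom (rep_id_subproof M).

Fact rep_comp_subproof (M N P : rep) (g : rep_hom N P) (f : rep_hom M N) :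
  (g \o f)%VF \in equivariant M P.
Proof. by apply/equivariantP => l m; rewrite !comp_lfunE !rep_homE. Qed.

Definition rep_comp (M N P : rep) (g : rep_hom N P) (f : rep_hom M N) :
  rep_hom M P := RepHom (rep_comp_subproof g f).

Fact rep_comp1m (M N : rep) (f : rep_hom M N) : rep_comp (rep_id N) f = f.
Proof. by apply/val_inj/comp_lfun1l. Qed.

Fact rep_compm1 (M N : rep) (f : rep_hom M N) : rep_comp f (rep_id M) = f.
Proof. by apply/val_inj/comp_lfun1r. Qed.

Fact rep_compA (M N P S : rep)
    (h : rep_hom P S) (g : rep_hom N P) (f : rep_hom M N) :
  rep_comp h (rep_comp g f) = rep_comp (rep_comp h g) f.
Proof. by apply/val_inj/comp_lfunA. Qed.

Definition RepCat : category := Category rep_comp1m rep_compm1 rep_compA.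

(* The zero representation, on the zero subspace of the line [k]. *)
Definition zero_rep : rep :=
  @Rep (subvs_of (0%VS : {vspace k^o})) (fun _ => \1%VF) erefl
    (fun _ _ => esym (comp_lfun1l _)).

End Rep.

Arguments equivariant {k L} M N.

Section Twist.
Variables (k : fieldType) (L : finGroupType) (phi : L -> L).
Hypothesis phiM : {morph phi : l l' / (l * l')%g}.

Fact twist_act1 (M : rep k L) : rep_act M (phi 1%g) = \1%VF.
Proof.
suff -> : phi 1%g = 1%g by exact: rep_act1.
by apply: (mulgI (phi 1%g)); rewrite -phiM !mulg1.
Qed.

Fact twist_actM (M : rep k L) l l' :
  rep_act M (phi (l * l')%g) = (rep_act M (phi l) \o rep_act M (phi l'))%VF.
Proof. by rewrite phiM rep_actM. Qed.

Definition twist_rep (M : rep k L) : rep k L :=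
  @Rep k L M (fun l => rep_act M (phi l)) (twist_act1 M) (twist_actM M).

Fact twist_map_subproof (M N : rep k L) (f : rep_hom M N) :
  rep_hom_val f \in equivariant (twist_rep M) (twist_rep N).
Proof. by apply/equivariantP => l m; rewrite /= rep_homE. Qed.

Definition twist_map (M N : rep k L) (f : rep_hom M N) :
  rep_hom (twist_rep M) (twist_rep N) := RepHom (twist_map_subproof f).

Fact twist_map1 (M : RepCat k L) :
  twist_map (idm M) = @idm (RepCat k L) (twist_rep M).
Proof. exact: val_inj. Qed.

Fact twist_mapM (M N P : RepCat k L) (g : hom N P) (f : hom M N) :
  twist_map (g ∘ f)
    = @cmp (RepCat k L) (twist_rep M) (twist_rep N) (twist_rep P)
        (twist_map g) (twist_map f).
Proof. exact: val_inj. Qed.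

Definition twist : functor (RepCat k L) (RepCat k L) :=
  @Functor (RepCat k L) (RepCat k L) twist_rep twist_map twist_map1 twist_mapM.

End Twist.

Section Dual.
Variables (k : fieldType) (L : finGroupType).

Section Transpose.
Variables V W : vectType k.

Definition transpose_fun (f : 'Hom(V, W)) (u : 'Hom(W, k^o)) : 'Hom(V, k^o) :=
  (u \o f)%VF.

Fact transpose_is_linear f : linear (transpose_fun f).
Proof. by move=> a u v; rewrite /transpose_fun comp_lfunDl comp_lfunZl. Qed.

HB.instance Definition _ f :=
  GRing.isLinear.Build k 'Hom(W, k^o) 'Hom(V, k^o) _ (transpose_fun f)
    (transpose_is_linear f).

Definition transpose (f : 'Hom(V, W)) : 'Hom('Hom(W, k^o), 'Hom(V, k^o)) :=
  linfun (transpose_fun f).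

Lemma transposeE f (u : 'Hom(W, k^o)) : transpose f u = (u \o f)%VF.
Proof. by rewrite lfunE. Qed.

End Transpose.

Hypothesis abL : abelian [set: L].

Lemma abelian_mulC (l l' : L) : (l * l' = l' * l)%g.
Proof. by apply: (centsP abL); rewrite inE. Qed.

Fact dual_act1 (M : rep k L) : transpose (rep_act M 1%g) = \1%VF.
Proof.
by apply/lfunP => u; rewrite transposeE rep_act1 comp_lfun1r id_lfunE.
Qed.

Fact dual_actM (M : rep k L) l l' :
  transpose (rep_act M (l * l')%g)
    = (transpose (rep_act M l) \o transpose (rep_act M l'))%VF.
Proof.
apply/lfunP => u.
by rewrite comp_lfunE !transposeE abelian_mulC rep_actM comp_lfunA.
Qed.

Definition dual_rep (M : rep k L) : rep k L :=
  @Rep k L 'Hom(M, k^o) (fun l => transpose (rep_act M l))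
    (dual_act1 M) (dual_actM M).

Fact dual_map_subproof (M N : rep k L) (f : rep_hom M N) :
  transpose f \in equivariant (dual_rep N) (dual_rep M).
Proof.
apply/equivariantP => l u /=; rewrite !transposeE -!comp_lfunA.
by congr (_ \o _)%VF; apply/lfunP => m; rewrite !comp_lfunE rep_homE.
Qed.

Definition dual_map (M N : rep k L) (f : rep_hom M N) :
  rep_hom (dual_rep N) (dual_rep M) := RepHom (dual_map_subproof f).

Fact dual_map1 (M : op_cat (RepCat k L)) :
  dual_map (idm M) = @idm (RepCat k L) (dual_rep M).
Proof.
apply/rep_homP => u.
by rewrite /= transposeE comp_lfun1r id_lfunE.
Qed.

Fact dual_mapM (M N P : op_cat (RepCat k L)) (g : hom N P) (f : hom M N) :
  dual_map (g ∘ f)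
    = @cmp (RepCat k L) (dual_rep M) (dual_rep N) (dual_rep P)
        (dual_map g) (dual_map f).
Proof.
apply/rep_homP => u.
by rewrite /= comp_lfunE !transposeE comp_lfunA.
Qed.

Definition dual : functor (op_cat (RepCat k L)) (RepCat k L) :=
  @Functor (op_cat (RepCat k L)) (RepCat k L)
    dual_rep (fun M N f => dual_map f) dual_map1 dual_mapM.

End Dual.

(* V/U, realised on the complement of U, with projection [quot U]. *)
Section Quotient.
Variables (k : fieldType) (V : vectType k) (U : {vspace V}).

Definition quot_space : vectType k := subvs_of (U^C)%VS.

Definition quot : 'Hom(V, quot_space) :=
  (linfun (vsproj (U^C)%VS) \o (\1 - projv U))%VF.

Lemma quot_valE v : vsval (quot v) = v - projv U v.
Proof.
rewrite comp_lfunE add_lfunE opp_lfunE id_lfunE lfunE /=.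
by rewrite vsprojK ?memv_projC.
Qed.

Lemma quot_eq0 v : (quot v == 0) = (v \in U).
Proof.
apply/eqP/idP => [/(congr1 vsval)|vU].
  by rewrite quot_valE linear0 => /eqP; rewrite subr_eq0 => /eqP->; apply: memv_proj.
by apply: val_inj; rewrite /= quot_valE projv_id // subrr.
Qed.

Lemma quot_val (x : quot_space) : quot (vsval x) = x.
Proof.
have /eqP px0 : projv U (vsval x) == 0 by rewrite -memv_ker lker_proj subvsP.
by apply: val_inj; rewrite /= quot_valE px0 subr0.
Qed.

End Quotient.

Section TensorKL.
Variables (k : fieldType) (L : finGroupType).

Definition basis_vect (V : vectType k) (i : 'I_(dim V)) : V :=
  r2v (delta_mx 0 i).

Lemma basis_vect_sum (V : vectType k) (v : V) :
  v = \sum_i v2r v 0 i *: basis_vect i.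
Proof.
apply: v2r_inj; rewrite linear_sum [LHS]row_sum_delta.
by apply: eq_bigr => i _; rewrite linearZ /= r2vK.
Qed.

Section Space.
Variables M N : rep k L.

(* The tensor product over k is the space of matrices, m ⊗ n being the matrix
   of products of coordinates; over kL one divides out the elements
   lm ⊗ n - m ⊗ ln, where l ∈ L and basis vectors m, n suffice by
   bilinearity (see [pure_balanced] and [ten_liftE]). *)
Definition pure_k (m : M) (n : N) : 'M[k]_(dim M, dim N) :=
  (v2r m)^T *m v2r n.

Definition relations : {vspace 'M[k]_(dim M, dim N)} :=
  <<[seq pure_k (rep_act M x.1 (basis_vect x.2.1)) (basis_vect x.2.2)
         - pure_k (basis_vect x.2.1) (rep_act N x.1 (basis_vect x.2.2))
     | x : L * ('I_(dim M) * 'I_(dim N))]>>%VS.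

Definition ten_space : vectType k := quot_space relations.

Definition pure (m : M) (n : N) : ten_space := quot relations (pure_k m n).

Record balanced (W : vectType k) (b : M -> N -> W) : Prop := Balanced {
  balanced_linear_l : forall n, linear (b^~ n);
  balanced_linear_r : forall m, linear (b m);
  balanced_act : forall l m n, b (rep_act M l m) n = b m (rep_act N l n) }.

Lemma balanced_sum (W : vectType k) (b : M -> N -> W) :
  (forall n, linear (b^~ n)) -> (forall m, linear (b m)) ->
  forall m n, b m n = \sum_i \sum_j
    (v2r m 0 i * v2r n 0 j) *: b (basis_vect i) (basis_vect j).
Proof.
move=> bl br m n.
have sumr I (r : seq I) (c : I -> k) F x :
    b x (\sum_(j <- r) c j *: F j) = \sum_(j <- r) c j *: b x (F j).
  elim: r => [|j r IHr]; last by rewrite !big_cons br IHr.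
  by rewrite !big_nil -[X in b x X](addNr 0) -scaleN1r br scaleN1r addNr.
have suml I (r : seq I) (c : I -> k) F y :
    b (\sum_(j <- r) c j *: F j) y = \sum_(j <- r) c j *: b (F j) y.
  elim: r => [|j r IHr]; last by rewrite !big_cons (bl y) IHr.
  by rewrite !big_nil -[X in b X y](addNr 0) -scaleN1r (bl y) scaleN1r addNr.
rewrite {1}[m]basis_vect_sum suml; apply: eq_bigr => i _.
rewrite {1}[n]basis_vect_sum sumr scaler_sumr.
by apply: eq_bigr => j _; rewrite scalerA.
Qed.

Lemma pure_k_linear_l n : linear (pure_k^~ n).
Proof. by move=> a m m'; rewrite /pure_k !linearP /= mulmxDl -scalemxAl. Qed.

Lemma pure_k_linear_r m : linear (pure_k m).
Proof. by move=> a n n'; rewrite /pure_k !linearP. Qed.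

Lemma pure_kE m n i j : pure_k m n i j = v2r m 0 i * v2r n 0 j.
Proof. by rewrite mxE big_ord1 !mxE. Qed.

Lemma relations_act l m n :
  pure_k (rep_act M l m) n - pure_k m (rep_act N l n) \in relations.
Proof.
pose b m n := pure_k (rep_act M l m) n - pure_k m (rep_act N l n).
rewrite -/(b m n) balanced_sum => [||x].
- apply: memv_suml => i _; apply: memv_suml => j _; apply/memvZ/memv_span.
  by apply/mapP; exists (l, (i, j)); rewrite ?mem_enum.
- move=> y a u v; rewrite /b linearP /= !pure_k_linear_l scalerBr.
  by rewrite opprD addrACA.
move=> a u v; rewrite /b linearP /= !pure_k_linear_r scalerBr.
by rewrite opprD addrACA.
Qed.

Lemma pure_balanced : balanced pure.
Proof.
split=> [n a m m'|m a n n'|l m n].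
- by rewrite /pure pure_k_linear_l linearP.
- by rewrite /pure pure_k_linear_r linearP.
by apply/eqP; rewrite -subr_eq0 -linearB quot_eq0 relations_act.
Qed.

Section Lift.
Variable W : vectType k.

Definition ten_lift_fun (b : M -> N -> W) (x : ten_space) : W :=
  \sum_i \sum_j vsval x i j *: b (basis_vect i) (basis_vect j).

Fact ten_lift_is_linear b : linear (ten_lift_fun b).
Proof.
move=> a x y; rewrite /ten_lift_fun scaler_sumr -big_split; apply: eq_bigr => i _.
rewrite /= scaler_sumr -big_split; apply: eq_bigr => j _ /=.
by rewrite !mxE scalerDl scalerA.
Qed.

HB.instance Definition _ b :=
  GRing.isLinear.Build k ten_space W _ (ten_lift_fun b) (ten_lift_is_linear b).

Definition ten_lift (b : M -> N -> W) : 'Hom(ten_space, W) :=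
  linfun (ten_lift_fun b).

(* Universal property of the tensor product over kL. *)
Lemma ten_liftE b m n : balanced b -> ten_lift b (pure m n) = b m n.
Proof.
move=> [bl br bL]; rewrite /ten_lift lfunE /= /ten_lift_fun.
pose g (A : 'M[k]_(dim M, dim N)) : W :=
  \sum_i \sum_j A i j *: b (basis_vect i) (basis_vect j).
have gP : linear g.
  move=> a A B; rewrite /g scaler_sumr -big_split; apply: eq_bigr => i _.
  rewrite /= scaler_sumr -big_split; apply: eq_bigr => j _ /=.
  by rewrite !mxE scalerDl scalerA.
pose gL := GRing.isLinear.Build k _ W _ g gP.
pose gl : {linear 'M[k]_(dim M, dim N) -> W} := HB.pack g gL.
have g_pure x y : gl (pure_k x y) = b x y.
  rewrite [RHS]balanced_sum //; apply: eq_bigr => i _; apply: eq_bigr => j _.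
  by rewrite pure_kE.
have relK : (relations <= lker (linfun gl))%VS.
  apply/span_subvP => _ /mapP[[l [i j]] _ ->] /=.
  by rewrite memv_ker (lfunE gl) (linearB gl) !g_pure bL subrr.
rewrite -g_pure -[LHS]/(gl (vsval (pure m n))) quot_valE (linearB gl).
have: projv relations (pure_k m n) \in relations by apply: memv_proj.
by move/(subvP relK); rewrite memv_ker (lfunE gl) => /eqP->; exact: subr0.
Qed.

Lemma pure_ext (f g : 'Hom(ten_space, W)) :
  (forall m n, f (pure m n) = g (pure m n)) -> f = g.
Proof.
move=> fg; apply/lfunP => x; rewrite -(quot_val x) (matrix_sum_delta (vsval x)).
rewrite !linear_sum; apply: eq_bigr => i _; rewrite !linear_sum.
apply: eq_bigr => j _; rewrite !linearZ /=; congr (_ *: _).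
suff -> : delta_mx i j = pure_k (basis_vect i) (basis_vect j) by apply: fg.
by rewrite /pure_k !r2vK trmx_delta mul_delta_mx.
Qed.

End Lift.
End Space.

Section Map.
Variables M M' N N' : rep k L.

Fact ten_map_balanced (f : rep_hom M M') (g : rep_hom N N') :
  balanced (fun m n => pure (f m) (g n)).
Proof.
have [pl pr pL] := pure_balanced M' N'.
split=> [n a x y|m a x y|l m n]; first by rewrite linearP pl.
  by rewrite linearP pr.
by rewrite !rep_homE pL.
Qed.

Definition ten_lfun (f : rep_hom M M') (g : rep_hom N N') :
    'Hom(ten_space M N, ten_space M' N') :=
  ten_lift (fun m n => pure (f m) (g n)).

Lemma ten_lfunE f g m n : ten_lfun f g (pure m n) = pure (f m) (g n).
Proof. exact: (ten_liftE _ _ (ten_map_balanced f g)). Qed.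

End Map.

Hypothesis abL : abelian [set: L].

Section Action.
Variables M N : rep k L.

Definition ten_act (l : L) : 'End(ten_space M N) :=
  ten_lift (fun m n => pure (rep_act M l m) n).

Lemma ten_actE l m n : ten_act l (pure m n) = pure (rep_act M l m) n.
Proof.
rewrite /ten_act ten_liftE //; have [pl pr pL] := pure_balanced M N.
split=> [y a u v|x a u v|l' x y]; first by rewrite linearP pl.
  by rewrite pr.
by rewrite -pL -!rep_actME abelian_mulC.
Qed.

Fact ten_act1 : ten_act 1%g = \1%VF.
Proof. by apply: pure_ext => m n; rewrite ten_actE rep_act1E id_lfunE. Qed.

Fact ten_actM l l' : ten_act (l * l')%g = (ten_act l \o ten_act l')%VF.
Proof.
by apply: pure_ext => m n; rewrite comp_lfunE !ten_actE rep_actME.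
Qed.

Definition ten_rep : rep k L := @Rep k L (ten_space M N) ten_act ten_act1 ten_actM.

End Action.

Fact ten_map_subproof (M M' N N' : rep k L) (f : rep_hom M M') (g : rep_hom N N') :
  ten_lfun f g \in equivariant (ten_rep M N) (ten_rep M' N').
Proof.
apply/forallP => l; apply/eqP/pure_ext => m n.
by rewrite !comp_lfunE /= !(ten_actE, ten_lfunE) rep_homE.
Qed.

Definition ten_map (M M' N N' : rep k L) (f : rep_hom M M') (g : rep_hom N N') :
  rep_hom (ten_rep M N) (ten_rep M' N') := RepHom (ten_map_subproof f g).

Let Rep2 := prod_cat (RepCat k L) (RepCat k L).

Fact ten_map1 (MN : Rep2) :
  ten_map (idm MN).1 (idm MN).2 = @idm (RepCat k L) (ten_rep MN.1 MN.2).
Proof.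
apply/val_inj/pure_ext => m n /=.
by rewrite ten_lfunE !id_lfunE.
Qed.

Fact ten_mapM (MN MN' MN'' : Rep2) (g : hom MN' MN'') (f : hom MN MN') :
  ten_map (g ∘ f).1 (g ∘ f).2
    = @cmp (RepCat k L) (ten_rep MN.1 MN.2) (ten_rep MN'.1 MN'.2)
        (ten_rep MN''.1 MN''.2) (ten_map g.1 g.2) (ten_map f.1 f.2).
Proof.
apply/val_inj/pure_ext => m n /=.
by rewrite comp_lfunE !ten_lfunE /= !comp_lfunE.
Qed.

Definition ten : functor Rep2 (RepCat k L) :=
  @Functor Rep2 (RepCat k L) (fun MN => ten_rep MN.1 MN.2)
    (fun MN MN' f => ten_map f.1 f.2) ten_map1 ten_mapM.

End TensorKL.

(* [cm_act g] is the automorphism α(g); it is invertible by [cm_act1] and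
   [cm_actM]. (Composition in [{perm H}] is in the opposite order, so that a
   left action is not a morphism to [Aut [set: H]].) *)
Record crossed_module (G H : finGroupType) := CrossedModule {
  cm_t : {morphism [set: H] >-> G};
  cm_act : G -> H -> H;
  cm_act1 : forall h, cm_act 1%g h = h;
  cm_actM : forall g g' h, cm_act (g * g')%g h = cm_act g (cm_act g' h);
  cm_act_morph : forall g, {morph cm_act g : h l / (h * l)%g};
  cm_equivariant : forall g h, cm_t (cm_act g h) = (g * cm_t h * g^-1)%g;
  cm_peiffer : forall h l, cm_act (cm_t h) l = (h * l * h^-1)%g }.

Section CrossedModule.
Variables (G H : finGroupType) (X : crossed_module G H).

Definition cm_im : {group G} := (cm_t X @* [set: H])%G.
Definition cm_ker : {group H} := ('ker (cm_t X))%G.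

Definition cm_L : finGroupType := subg_of cm_ker.

(* Elements of [coset_of K] are the cosets in 'N(K)/K = G/K, as K is normal. *)
Definition cm_Q : finGroupType := coset_of cm_im.

Lemma cm_im_norm (g : G) : g \in ('N(cm_im))%g.
Proof.
rewrite inE; apply/subsetP => _ /imsetP[_ /morphimP[h _ _ ->] ->].
rewrite conjgE mulgA -{2}[g]invgK -(cm_equivariant X).
by apply: mem_morphim; rewrite inE.
Qed.

Lemma cm_ker_t (l : cm_L) : cm_t X (sgval l) = 1%g.
Proof. by apply: mker; apply: subgP. Qed.

Lemma cm_kerP (h : H) : (h \in cm_ker) = (cm_t X h == 1%g).
Proof. by rewrite !inE. Qed.

Lemma cm_L_abelian : abelian [set: cm_L].
Proof.
apply/centsP => l _ l' _; apply: val_inj; rewrite /=.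
apply/(mulIg (sgval l)^-1)%g.
by rewrite -(cm_peiffer X) cm_ker_t cm_act1 mulgK.
Qed.

Lemma cm_act_ker g (h : H) : h \in cm_ker -> cm_act X g h \in cm_ker.
Proof.
rewrite !cm_kerP cm_equivariant => /eqP ->.
by rewrite mulg1 mulgV.
Qed.

(* ᾱ(q), computed on a representative of q; by [cm_actL_coset] any other
   representative gives the same result. *)
Definition cm_actL (q : cm_Q) (l : cm_L) : cm_L :=
  subg cm_ker (cm_act X (repr q) (sgval l)).

Lemma cm_actL_val q l : sgval (cm_actL q l) = cm_act X (repr q) (sgval l).
Proof. by rewrite subgK // cm_act_ker ?subgP. Qed.

Lemma cm_actL_coset g l :
  sgval (cm_actL (coset cm_im g) l) = cm_act X g (sgval l).
Proof.
rewrite cm_actL_val val_coset ?cm_im_norm //.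
have: (repr (cm_im :* g) \in cm_im :* g)%g by apply: mem_repr (rcoset_refl _ _).
case/rcosetP => _ /morphimP[h _ _ ->] ->.
set l' := cm_act X g (sgval l).
have l'L : l' \in cm_ker by apply/cm_act_ker/subgP.
rewrite cm_actM cm_peiffer -/l'.
apply: (mulIg h); rewrite mulgKV; apply/(mulIg l'^-1)%g.
rewrite mulgK -(cm_peiffer X).
by rewrite (eqP (_ : cm_t X l' == 1%g)) -?cm_kerP // cm_act1.
Qed.

Lemma cm_actL_morph q : {morph cm_actL q : l l' / (l * l')%g}.
Proof.
by move=> l l'; apply: val_inj; rewrite /= !cm_actL_val /= cm_act_morph.
Qed.

End CrossedModule.

Section GradedRep.
Variables (k : fieldType) (G H : finGroupType) (X : crossed_module G H).

Let L := cm_L X.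
Let Q := cm_Q X.

(* Objects and morphisms of the direct sum over Q are families indexed by Q;
   the finiteness of Q makes every family finitely supported. *)
Definition gobj : Type := Q -> rep k L.
Definition ghom (A B : gobj) : Type := forall q, rep_hom (A q) (B q).

Definition gid (A : gobj) : ghom A A := fun q => rep_id (A q).
Definition gcomp (A B C : gobj) (g : ghom B C) (f : ghom A B) : ghom A C :=
  fun q => rep_comp (g q) (f q).

Fact gcomp1m (A B : gobj) (f : ghom A B) : gcomp (gid B) f = f.
Proof. by apply: functional_extensionality_dep => q; apply: rep_comp1m. Qed.

Fact gcompm1 (A B : gobj) (f : ghom A B) : gcomp f (gid A) = f.
Proof. by apply: functional_extensionality_dep => q; apply: rep_compm1. Qed.

Fact gcompA (A B C D : gobj) (h : ghom C D) (g : ghom B C) (f : ghom A B) :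
  gcomp h (gcomp g f) = gcomp (gcomp h g) f.
Proof. by apply: functional_extensionality_dep => q; apply: rep_compA. Qed.

Definition RepG : category := Category gcomp1m gcompm1 gcompA.

Definition ghom_add (A B : RepG) (f g : hom A B) : hom A B :=
  fun q => f q + g q.

Definition ghom_scale (A B : RepG) (a : k) (f : hom A B) : hom A B :=
  fun q => a *: f q.

Section Homogeneous.
Variable p : Q.

Definition homog_obj (M : RepCat k L) : RepG :=
  fun q => if q == p then M else zero_rep k L.

Definition homog_map (M N : RepCat k L) (f : hom M N) :
    hom (homog_obj M) (homog_obj N) :=
  fun q =>
    if q == p as b return rep_hom (if b then M else zero_rep k L)
                                  (if b then N else zero_rep k L)
    then f else rep_id (zero_rep k L).

Fact homog_map1 (M : RepCat k L) : homog_map (idm M) = idm (homog_obj M).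
Proof.
apply: functional_extensionality_dep => q.
by rewrite /homog_map /= /gid /homog_obj; case: (q == p).
Qed.

Fact homog_mapM (M N P : RepCat k L) (g : hom N P) (f : hom M N) :
  homog_map (g ∘ f) = homog_map g ∘ homog_map f.
Proof.
apply: functional_extensionality_dep => q.
rewrite /homog_map /= /gcomp /homog_obj; case: (q == p) => //.
by rewrite rep_comp1m.
Qed.

Definition homog : functor (RepCat k L) RepG := Functor homog_map1 homog_mapM.

End Homogeneous.

Definition rep_twist (q : Q) : functor (RepCat k L) (RepCat k L) :=
  twist k (cm_actL_morph q).

Definition rep_ten : functor (prod_cat (RepCat k L) (RepCat k L)) (RepCat k L) :=
  ten k (cm_L_abelian X).

Definition rep_dual : functor (op_cat (RepCat k L)) (RepCat k L) :=
  dual k (cm_L_abelian X).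

(* An object being the direct sum of its homogeneous components, a bilinear
   tensor product and a linear dual are determined by their values on
   homogeneous objects. *)
Definition tensor_bilinear (T : functor (prod_cat RepG RepG) RepG) : Prop :=
  forall (A A' B B' : RepG) (a : k),
    (forall (f f' : hom A A') (g : hom B B'),
       tensm T (ghom_add (ghom_scale a f) f') g
         = ghom_add (ghom_scale a (tensm T f g)) (tensm T f' g)) /\
    (forall (f : hom A A') (g g' : hom B B'),
       tensm T f (ghom_add (ghom_scale a g) g')
         = ghom_add (ghom_scale a (tensm T f g)) (tensm T f g')).

Definition dual_linear (D : functor (op_cat RepG) RepG) : Prop :=
  forall (A B : RepG) (a : k) (f g : hom A B),
    @fmap (op_cat RepG) RepG D B A (ghom_add (ghom_scale a f) g)
      = ghom_add (ghom_scale a (@fmap (op_cat RepG) RepG D B A f))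
                 (@fmap (op_cat RepG) RepG D B A g).

End GradedRep.

Arguments RepG k {G H} X.
Arguments homog k {G H} X p.
Arguments rep_twist k {G H} X q.
Arguments rep_ten k {G H} X.
Arguments rep_dual k {G H} X.

(* Main.v *)
From HB Require Import structures.
From Stdlib Require Import FunctionalExtensionality.
Require Import Defs.
From mathcomp Require Import all_boot all_order all_fingroup all_algebra.

(** Write Q for the grading group, acting by automorphisms alpha on the finite
    abelian group L. Grade the tensor product by

      (A ⊗ B)_s = the sum over p * q = s of A_p ⊗ B_q,

    where the tensor product is over kL with B_q twisted by p^-1, so that
    l a ⊗ b = a ⊗ (alpha p^-1 l) b. It represents the families of bilinear maps
    satisfying this rule, and every structure map is given by a formula on pure
    tensors. The associator a ⊗ (b ⊗ c) is well defined because alpha is an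
    action ([gassoc]). The unit is kL in degree 1, with l ⊗ a = l a and
    a ⊗ l = (alpha p l) a for a of degree p ([glunit], [grunit]). The pentagon
    and the triangle are comparisons of pure tensors ([gpentagon],
    [gtriangle]).

    For the dual, let lambda be the coefficient at 1 of an element of kL. A
    morphism f of L-modules from a module to kL is determined by the linear
    form lambda f, since f x is the sum over l of lambda (f (l^-1 x)) l, and
    every linear form arises in this way. So a morphism from A ⊗ B to the unit
    is a linear form on the component of degree 1 of A ⊗ B, that is, for each q
    a pairing of A_(q^-1) with B_q in which l on B_q is moved to alpha q^-1 l on
    A_(q^-1). This is a morphism from B to the object D A whose component of
    degree q is the dual of A_(q^-1) twisted by q^-1 ([curryK], [uncurryK]).
    Applying D twice gives the bidual, as the two twists cancel, and finite
    dimension makes D an equivalence ([ddual_inj], [dim_ddual]).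

    On objects concentrated in one degree only one summand survives, which
    gives the two formulas for homogeneous objects ([conc_ten], [conc_dual]). *)

Set Implicit Arguments.
Unset Strict Implicit.
Unset Printing Implicit Defensive.

Import GRing.Theory VectorInternalTheory.
Local Open Scope cat_scope.
Local Open Scope ring_scope.

(** * Linear maps and finite direct sums *)

Section LinearMap.
Variables (k : fieldType) (V W : vectType k).

Definition lin_hom (f : V -> W) (f_lin : linear f) : 'Hom(V, W) :=
  linfun (HB.pack f (GRing.isLinear.Build k V W _ f f_lin) : {linear V -> W}).

Lemma lin_homE f f_lin : @lin_hom f f_lin =1 f.
Proof. by move=> v; rewrite lfunE. Qed.

Lemma ker0_dim_inv (f : 'Hom(V, W)) :
  lker f == 0%VS -> dim V = dim W -> (f^-1 \o f = \1 /\ f \o f^-1 = \1)%VF.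
Proof.
move=> f_inj eq_dim; split; first exact: lker0_compVf.
apply/lfunP=> w; rewrite comp_lfunE id_lfunE limg_lfunVK //.
suff ->: limg f = fullv by apply: memvf.
apply/eqP; rewrite eqEdim subvf /=.
by rewrite limg_dim_eq ?(eqP f_inj) ?capv0 // !dimvf eq_dim.
Qed.

End LinearMap.

(** External direct sum of a family of spaces [V i]. The family depends on the
    index, so the sum is cut out of the functions from [I] to rows of a common
    length [N], into which every [V i] embeds by padding: comparing two indices
    then never requires transporting a vector along an equality. *)
Section DirectSum.
Variables (k : fieldType) (I : finType) (V : I -> vectType k).

Let N := \max_i dim (V i).
Let W : vectType k := {ffun I -> 'rV[k]_N}.

Definition dsum_pad_fun i (v : V i) : W :=
  [ffun j => if j == i then v2r v *m pid_mx (dim (V i)) else 0].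

Fact dsum_pad_linear i : linear (@dsum_pad_fun i).
Proof.
move=> a u v; apply/ffunP=> j; rewrite !ffunE.
by case: (j == i); rewrite ?scaler0 ?addr0 // linearP /= mulmxDl -scalemxAl.
Qed.

Definition dsum_cut_fun i (f : W) : V i := r2v (f i *m pid_mx (dim (V i))).

Fact dsum_cut_linear i : linear (@dsum_cut_fun i).
Proof.
by move=> a f g; rewrite /dsum_cut_fun !ffunE mulmxDl -scalemxAl linearP.
Qed.

Definition dsum_pad i := lin_hom (@dsum_pad_linear i).
Definition dsum_cut i := lin_hom (@dsum_cut_linear i).

Lemma dsum_padK i : cancel (dsum_pad i) (dsum_cut i).
Proof.
move=> v; rewrite !lin_homE /dsum_cut_fun ffunE eqxx -mulmxA mul_pid_mx.
have le_iN : (dim (V i) <= N)%N by rewrite /N (leq_bigmax i).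
by rewrite minnn (minn_idPr le_iN) pid_mx_1 mulmx1 v2rK.
Qed.

Lemma dsum_cut_pad i j v : i != j -> dsum_cut i (dsum_pad j v) = 0.
Proof.
move=> neq_ij; rewrite !lin_homE /dsum_cut_fun ffunE (negPf neq_ij).
by rewrite mul0mx linear0.
Qed.

Definition dsum_vspace : {vspace W} := (\sum_i limg (dsum_pad i))%VS.
Definition dsum : vectType k := subvs_of dsum_vspace.

Definition dsum_in i : 'Hom(V i, dsum) :=
  (linfun (vsproj dsum_vspace) \o dsum_pad i)%VF.
Definition dsum_pr i : 'Hom(dsum, V i) :=
  (dsum_cut i \o linfun vsval)%VF.

Lemma dsum_in_val i v : vsval (dsum_in i v) = dsum_pad i v.
Proof.
rewrite comp_lfunE lfunE /= vsprojK //.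
by apply: (subvP (sumv_sup i _ (subvv _))) => //; apply: memv_img (memvf v).
Qed.

Lemma dsum_prE i x : dsum_pr i x = dsum_cut i (vsval x).
Proof. by rewrite comp_lfunE [linfun _ x]lfunE. Qed.

Lemma dsum_inK i : cancel (dsum_in i) (dsum_pr i).
Proof. by move=> v; rewrite dsum_prE dsum_in_val dsum_padK. Qed.

Lemma dsum_pr_in i j v : i != j -> dsum_pr i (dsum_in j v) = 0.
Proof. by move=> neq_ij; rewrite dsum_prE dsum_in_val dsum_cut_pad. Qed.

Lemma dsum_sum x : x = \sum_i dsum_in i (dsum_pr i x).
Proof.
apply: val_inj; rewrite linear_sum /=.
have [w w_in def_x] := memv_sumP (subvsP x).
rewrite def_x; apply: eq_bigr => i _; rewrite dsum_in_val dsum_prE def_x.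
rewrite linear_sum (bigD1 i) //= big1 ?addr0 => [|j neq_ji].
  by have /memv_imgP[v _ ->] := w_in i isT; rewrite dsum_padK.
have /memv_imgP[v _ ->] := w_in j isT.
by rewrite dsum_cut_pad // eq_sym.
Qed.

End DirectSum.

(** * Representations and group actions *)

Section RepHomTheory.
Variables (k : fieldType) (L : finGroupType).

Definition mk_rep_hom (M N : rep k L) (f : 'Hom(M, N))
    (fE : forall l m, f (rep_act M l m) = rep_act N l (f m)) : rep_hom M N :=
  RepHom (introT (equivariantP f) fE).

Lemma rep_hom_scaleD (M N : rep k L) a (f g : rep_hom M N) m :
  (a *: f + g) m = a *: f m + g m.
Proof. by rewrite /= add_lfunE scale_lfunE. Qed.

Lemma rep_iso_inv (M N : rep k L) (f : rep_hom M N) :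
  lker f == 0%VS -> dim M = dim N ->
  {g : rep_hom N M | rep_comp g f = rep_id M /\ rep_comp f g = rep_id N}.
Proof.
move=> f_inj eq_dim; have [fK Kf] := ker0_dim_inv f_inj eq_dim.
have gE l n : (f^-1)%VF (rep_act N l n) = rep_act M l ((f^-1)%VF n).
  have fKE m : (f^-1)%VF (f m) = m by rewrite -comp_lfunE fK id_lfunE.
  have KfE m : f ((f^-1)%VF m) = m by rewrite -comp_lfunE Kf id_lfunE.
  by rewrite -{1}[n]KfE -rep_homE fKE.
by exists (mk_rep_hom gE); split; apply: val_inj.
Qed.

Lemma linear_fun0 (V W : vectType k) (f : V -> W) : linear f -> f 0 = 0.
Proof. by move=> f_lin; rewrite -(lin_homE f_lin) linear0. Qed.

End RepHomTheory.

(** The construction sees the crossed module only through the action of the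
    group [Q] on the abelian group [L], so it is carried out for any such
    action. *)
Record actionByAut (Q L : finGroupType) := ActionByAut {
  aut_act :> Q -> L -> L;
  aut_act_morph : forall q, {morph aut_act q : l l' / (l * l')%g};
  aut_act1 : forall l, aut_act 1%g l = l;
  aut_actM : forall p q l, aut_act (p * q)%g l = aut_act p (aut_act q l) }.

Section AutAction.
Variables (Q L : finGroupType) (alpha : actionByAut Q L).

Lemma aut_actK q : cancel (alpha q) (alpha q^-1%g).
Proof. by move=> l; rewrite -aut_actM mulVg aut_act1. Qed.

Lemma aut_actVK q : cancel (alpha q^-1%g) (alpha q).
Proof. by move=> l; rewrite -aut_actM mulgV aut_act1. Qed.

End AutAction.

Section ActionOnL.
Variables (G H : finGroupType) (X : crossed_module G H).

Lemma cm_Q_rep (q : cm_Q X) : exists g, q = coset (cm_im X) g.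
Proof. by case: (cosetP q) => g _ ->; exists g. Qed.

(** [cm_actL] is computed on representatives of cosets; independence of the
    representative turns the identities of [cm_act] into those of an action. *)
Lemma cm_actL1 (l : cm_L X) : cm_actL 1%g l = l.
Proof.
apply: val_inj; rewrite /= -(morph1 (coset_morphism (cm_im X))).
by rewrite cm_actL_coset cm_act1.
Qed.

Lemma cm_actLM (p q : cm_Q X) l : cm_actL (p * q)%g l = cm_actL p (cm_actL q l).
Proof.
have [[g ->] [h ->]] := (cm_Q_rep p, cm_Q_rep q).
rewrite -(morphM (coset_morphism (cm_im X))) ?cm_im_norm //.
by apply: val_inj; rewrite /= !cm_actL_coset cm_actM.
Qed.

Definition cm_actionByAut : actionByAut (cm_Q X) (cm_L X) :=
  ActionByAut (@cm_actL_morph G H X) cm_actL1 cm_actLM.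

End ActionOnL.

(** * Existence of the graded tensor product *)

Section GradedTensor.
Variables (k : fieldType) (L Q : finGroupType).
Variables (abL : abelian [set: L]) (alpha : actionByAut Q L).

Definition graded := Q -> rep k L.

Definition tw (p : Q) (M : rep k L) : rep k L :=
  twist_rep (aut_act_morph alpha p) M.

Lemma twE p M l : rep_act (tw p M) l = rep_act M (alpha p l).
Proof. by []. Qed.

Section Object.
Variables A B : graded.

(** Indexing by the pairs [(p, q)] of product [s], rather than by [p] alone with
    [q = p^-1 s], lets [A p] and [B q] occur without transport. *)
Definition pair_index (s : Q) : finType := {x : Q * Q | (x.1 * x.2)%g == s}.

Definition pair_summand s (i : pair_index s) : vectType k :=
  ten_space (A (val i).1) (tw (val i).1^-1%g (B (val i).2)).

Definition pair_space s : vectType k := dsum (@pair_summand s).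

(** Defined for all degrees, with value 0 unless [p * q = s]: identities between
    pure tensors then mention no proof of an equality of degrees. *)
Definition pair_pure s p q (m : A p) (n : B q) : pair_space s :=
  match eq_comparable (p * q)%g s with
  | left e =>
      @dsum_in k _ (@pair_summand s) (exist _ (p, q) (introT eqP e))
        (@pure k L (A p) (tw p^-1%g (B q)) m n)
  | right _ => 0
  end.

Definition gbalanced (W : vectType k) (b : forall p q, A p -> B q -> W) :=
  forall p q, @balanced k L (A p) (tw p^-1%g (B q)) W (b p q).

Definition pair_lift s (W : vectType k) (b : forall p q, A p -> B q -> W) :
    'Hom(pair_space s, W) :=
  \sum_(i : pair_index s)
    (@ten_lift k L (A (val i).1) (tw (val i).1^-1%g (B (val i).2)) W
        (b (val i).1 (val i).2) \o @dsum_pr k _ (@pair_summand s) i)%VF.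

Lemma pair_pure0 s p q m n : (p * q)%g <> s -> @pair_pure s p q m n = 0.
Proof. by rewrite /pair_pure; case: eq_comparable. Qed.

Lemma pair_liftE s W b p q m n :
  gbalanced b -> (p * q)%g = s -> @pair_lift s W b (pair_pure s m n) = b p q m n.
Proof.
move=> b_bal def_s; rewrite /pair_pure; case: eq_comparable => // e.
rewrite /pair_lift sum_lfunE (bigD1 (exist _ (p, q) (introT eqP e))) //.
rewrite big1 => [|i neq_i].
  by rewrite [LHS]addr0 comp_lfunE dsum_inK [LHS]ten_liftE.
by rewrite comp_lfunE dsum_pr_in // linear0.
Qed.

Lemma pair_ext s (W : vectType k) (f g : 'Hom(pair_space s, W)) :
  (forall p q (m : A p) (n : B q), (p * q)%g = s ->
     f (pair_pure s m n) = g (pair_pure s m n)) -> f = g.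
Proof.
move=> fg; apply/lfunP=> x; rewrite [x]dsum_sum !linear_sum.
apply: eq_bigr => i _.
pose in_i := @dsum_in k _ (@pair_summand s) i.
suff fg_i: (f \o in_i)%VF = (g \o in_i)%VF.
  by move/lfunP: fg_i => /(_ (dsum_pr _ i x)); rewrite !comp_lfunE.
apply: pure_ext => m n; rewrite [LHS]comp_lfunE [RHS]comp_lfunE /in_i {in_i}.
case: i m n => -[p q] e m n.
have := fg p q m n (eqP e); rewrite /pair_pure.
case: eq_comparable => [e1|neq_s]; last by case: (neq_s (eqP e)).
by rewrite (bool_irrelevance e (introT eqP e1)).
Qed.

Lemma pair_pure_balanced s : gbalanced (@pair_pure s).
Proof.
move=> p q; rewrite /pair_pure; case: eq_comparable => [e|_]; last first.
  by split=> [n a u v|m a u v|l m n] //; rewrite scaler0 addr0.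
have [bl br bL] := pure_balanced (A p) (tw p^-1%g (B q)).
by split=> [n a u v|m a u v|l m n]; rewrite ?bl ?br ?bL ?linearP.
Qed.

Lemma pair_pure_linear_l s p q n : linear ((@pair_pure s p q)^~ n).
Proof. by have [bl _ _] := @pair_pure_balanced s p q; apply: bl. Qed.

Lemma pair_pure_linear_r s p q m : linear (@pair_pure s p q m).
Proof. by have [_ br _] := @pair_pure_balanced s p q; apply: br. Qed.

Lemma pair_pure_act s p q l m n :
  pair_pure s (rep_act (A p) l m) n
    = @pair_pure s p q m (rep_act (B q) (alpha p^-1%g l) n).
Proof. by have [_ _ bL] := @pair_pure_balanced s p q; apply: bL. Qed.

Definition pair_act s (l : L) : 'End(pair_space s) :=
  pair_lift s (fun p q m n => pair_pure s (rep_act (A p) l m) n).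

Lemma pair_actE s l p q (m : A p) (n : B q) :
  pair_act s l (pair_pure s m n) = pair_pure s (rep_act (A p) l m) n.
Proof.
have [def_s | /eqP neq_s] := altP ((p * q)%g =P s); last first.
  by rewrite !pair_pure0 ?linear0.
rewrite pair_liftE // {p q m n def_s} => p q; split=> [n a u v|m a u v|l' m n].
- by rewrite linearP pair_pure_linear_l.
- by rewrite pair_pure_linear_r.
by rewrite -pair_pure_act -!rep_actME (abelian_mulC abL).
Qed.

Fact pair_act1 s : pair_act s 1%g = \1%VF.
Proof. by apply: pair_ext => p q m n _; rewrite pair_actE rep_act1E id_lfunE. Qed.

Fact pair_actM s l l' :
  pair_act s (l * l')%g = (pair_act s l \o pair_act s l')%VF.
Proof. by apply: pair_ext => p q m n _; rewrite comp_lfunE !pair_actE rep_actME. Qed.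

(** The component of degree [s] of A ⊗ B, known by its universal property only:
    maps out of it are the families [b] that are balanced for the action of L
    on [B q] twisted by [p^-1], with [p * q = s]. *)
Record tensor_component s := TensorComponent {
  tc_rep : rep k L;
  tc_pure : forall p q, A p -> B q -> tc_rep;
  tc_pure0 : forall p q (m : A p) (n : B q), (p * q)%g <> s -> tc_pure m n = 0;
  tc_balanced : gbalanced tc_pure;
  tc_act : forall l p q (m : A p) (n : B q),
    rep_act tc_rep l (tc_pure m n) = tc_pure (rep_act (A p) l m) n;
  tc_lift : forall (W : vectType k) (b : forall p q, A p -> B q -> W),
    gbalanced b ->
    {f : 'Hom(tc_rep, W) | forall p q (m : A p) (n : B q),
       (p * q)%g = s -> f (tc_pure m n) = b p q m n};
  tc_ext : forall (W : vectType k) (f g : 'Hom(tc_rep, W)),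
    (forall p q (m : A p) (n : B q), (p * q)%g = s ->
       f (tc_pure m n) = g (tc_pure m n)) -> f = g }.

(** Opaque on purpose: the direct sum above serves only to show that a component
    exists, and coherence is easier to check from the universal property. *)
Fact tensor_component_exists s : tensor_component s.
Proof.
apply: (@TensorComponent s (Rep (pair_act1 s) (pair_actM s)) (@pair_pure s)).
- exact: pair_pure0.
- exact: pair_pure_balanced.
- exact: pair_actE.
- by move=> W b b_bal; exists (pair_lift s b) => p q m n; apply: pair_liftE.
exact: pair_ext.
Qed.

End Object.
End GradedTensor.

(** * The graded tensor product from its universal property *)

Section GradedTensorTheory.
Variables (k : fieldType) (L Q : finGroupType).
Variables (abL : abelian [set: L]) (alpha : actionByAut Q L).

Local Notation graded := (graded k L Q).

Definition gten (A B : graded) : graded :=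
  fun s => tc_rep (tensor_component_exists abL alpha A B s).

Section Pure.
Variables A B : graded.

Definition gpure s p q (m : A p) (n : B q) : gten A B s := tc_pure _ m n.

Local Notation "x ⊠[ s ] y" := (gpure s x y) (at level 45, format "x  ⊠[ s ]  y").

Lemma gpure0 s p q (m : A p) (n : B q) : (p * q)%g <> s -> m ⊠[s] n = 0.
Proof. exact: tc_pure0. Qed.

Lemma gpure_linear_l s p q (n : B q) : linear (fun m : A p => m ⊠[s] n).
Proof.
have [bl _ _] := tc_balanced (tensor_component_exists abL alpha A B s) p q.
exact: bl.
Qed.

Lemma gpure_linear_r s p q (m : A p) : linear (fun n : B q => m ⊠[s] n).
Proof.
have [_ br _] := tc_balanced (tensor_component_exists abL alpha A B s) p q.
exact: br.
Qed.

Lemma gpure0l s p q (n : B q) : (0 : A p) ⊠[s] n = 0.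
Proof. exact: linear_fun0 (gpure_linear_l s n). Qed.

Lemma gpure0r s p q (m : A p) : m ⊠[s] (0 : B q) = 0.
Proof. exact: linear_fun0 (gpure_linear_r s m). Qed.

Lemma gpure_act s p q l (m : A p) (n : B q) :
  rep_act (A p) l m ⊠[s] n = m ⊠[s] rep_act (B q) (alpha p^-1%g l) n.
Proof.
have [_ _ bL] := tc_balanced (tensor_component_exists abL alpha A B s) p q.
exact: bL.
Qed.

Lemma gpure_shift_act s p q l (m : A p) (n : B q) :
  m ⊠[s] rep_act (B q) l n = rep_act (A p) (alpha p l) m ⊠[s] n.
Proof. by rewrite gpure_act aut_actK. Qed.

Lemma gten_act_pure s p q l (m : A p) (n : B q) :
  rep_act (gten A B s) l (m ⊠[s] n) = rep_act (A p) l m ⊠[s] n.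
Proof. exact: tc_act. Qed.

Lemma gext s (W : vectType k) (f g : 'Hom(gten A B s, W)) :
  (forall p q (m : A p) (n : B q), (p * q)%g = s -> f (m ⊠[s] n) = g (m ⊠[s] n)) ->
  f = g.
Proof. exact: tc_ext. Qed.

(** The form of extensionality used to prove that a formula involving an
    arbitrary element of the tensor product holds: check linearity on both
    sides, then compare on pure tensors. *)
Lemma gten_eq s (W : vectType k) (f g : gten A B s -> W) :
  linear f -> linear g ->
  (forall p q (m : A p) (n : B q), (p * q)%g = s -> f (m ⊠[s] n) = g (m ⊠[s] n)) ->
  f =1 g.
Proof.
move=> f_lin g_lin fg x; rewrite -(lin_homE f_lin) -(lin_homE g_lin).
congr (fun_of_lfun _ x); apply: gext => p q m n def_s.
by rewrite !lin_homE fg.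
Qed.

Lemma gten_rep_eq s (N : rep k L) (f g : rep_hom (gten A B s) N) :
  (forall p q (m : A p) (n : B q), (p * q)%g = s -> f (m ⊠[s] n) = g (m ⊠[s] n)) ->
  f = g.
Proof. by move=> fg; apply/val_inj/gext. Qed.

Section Lift.
Variables (s : Q) (W : vectType k) (b : forall p q, A p -> B q -> W).
Hypothesis b_bal : gbalanced alpha b.

Definition glift : 'Hom(gten A B s, W) := sval (tc_lift _ b_bal).

Lemma gliftE p q (m : A p) (n : B q) :
  (p * q)%g = s -> glift (m ⊠[s] n) = b m n.
Proof. exact: (svalP (tc_lift _ b_bal)). Qed.

End Lift.

Lemma gten_lift s (N : rep k L) (b : forall p q, A p -> B q -> N) :
  gbalanced alpha b ->
  (forall p q l m n, b p q (rep_act (A p) l m) n = rep_act N l (b p q m n)) ->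
  {f : rep_hom (gten A B s) N | forall p q (m : A p) (n : B q),
    (p * q)%g = s -> f (m ⊠[s] n) = b p q m n}.
Proof.
move=> b_bal bL.
have liftL l x :
  glift s b_bal (rep_act (gten A B s) l x) = rep_act N l (glift s b_bal x).
  rewrite -!comp_lfunE; congr (fun_of_lfun _ x); apply: gext => p q m n def_s.
  by rewrite !comp_lfunE gten_act_pure !gliftE.
by exists (mk_rep_hom liftL) => p q m n; apply: gliftE.
Qed.

End Pure.
End GradedTensorTheory.

Arguments glift {k L Q} abL {alpha A B} s {W b} b_bal.
Arguments gten_lift {k L Q} abL {alpha A B} s {N b} b_bal bL.
Arguments gpure {k L Q} abL alpha {A B} s {p q} m n.

(** * Change of degree and the unit object *)

Section Cast.
Variables (k : fieldType) (L Q : finGroupType).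

(** Total in the degrees, with value 0 when they differ, so that formulas need no
    proof that two degrees agree. *)
Definition gcast (A : graded k L Q) p q : rep_hom (A p) (A q) :=
  match eq_comparable p q with
  | left e => match e in _ = r return rep_hom (A p) (A r) with
              | erefl => rep_id (A p)
              end
  | right _ => 0
  end.

Lemma gcast_id A p m : gcast A p p m = m.
Proof.
rewrite /gcast; case: eq_comparable => // e.
by rewrite (eq_axiomK e) /= id_lfunE.
Qed.

Lemma gcast0 A p q m : p <> q -> gcast A p q m = 0.
Proof. by rewrite /gcast; case: eq_comparable => // _ _; apply: zero_lfunE. Qed.

Lemma gcast_nat (A B : graded k L Q) (f : forall q, rep_hom (A q) (B q)) p q m :
  gcast B p q (f p m) = f q (gcast A p q m).
Proof.
case: (p =P q) => [<-|neq_pq]; first by rewrite !gcast_id.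
by rewrite !gcast0 // linear0.
Qed.

End Cast.

Section Unit.
Variables (k : fieldType) (L Q : finGroupType).

Section Component.
Variable q : Q.

Let I : finType := {x : L | q == 1%g}.
(** The regular representation kL when [q = 1] and the zero space otherwise,
    without a case distinction: [I] is a copy of [L] or empty. *)
Definition gunit_space : vectType k := {ffun I -> k^o}.

Definition gdelta l : gunit_space := [ffun x : I => (val x == l)%:R].

Definition gcoef_fun l (u : gunit_space) : k^o := \sum_(x : I | val x == l) u x.

Fact gcoef_linear l : linear (gcoef_fun l).
Proof.
move=> a u v; rewrite /gcoef_fun scaler_sumr -big_split.
by apply: eq_bigr => x _; rewrite !ffunE.
Qed.

Definition gcoef l := lin_hom (@gcoef_linear l).

Lemma gdelta0 l : q <> 1%g -> gdelta l = 0.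
Proof. by move=> /eqP/negP neq_q1; apply/ffunP=> -[x e]; case: (neq_q1 e). Qed.

Lemma gcoef_delta l l' : q = 1%g -> gcoef l (gdelta l') = (l == l')%:R.
Proof.
move=> /eqP q1; rewrite lin_homE /gcoef_fun (big_pred1 (exist _ l q1)) ?ffunE //.
Qed.

Lemma gcoef_sum u : u = \sum_l gcoef l u *: gdelta l.
Proof.
apply/ffunP=> x; rewrite sum_ffunE (bigD1 (val x)) //= big1 ?addr0 => [|l neq_lx].
  rewrite !ffunE lin_homE /gcoef_fun (big_pred1 x) //= eqxx.
  by rewrite [RHS]mulr1.
by rewrite !ffunE eq_sym (negPf neq_lx) scaler0.
Qed.

Lemma gunit_ext (W : vectType k) (f g : 'Hom(gunit_space, W)) :
  (forall l, q = 1%g -> f (gdelta l) = g (gdelta l)) -> f = g.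
Proof.
move=> fg; apply/lfunP=> u; rewrite [u]gcoef_sum !linear_sum.
apply: eq_bigr => l _; rewrite !linearZ /=; congr (_ *: _).
by case: (q =P 1%g) => [/(fg l) //|neq_q1]; rewrite gdelta0 ?linear0.
Qed.

Definition gunit_lift_fun (W : vectType k) (b : L -> W) (u : gunit_space) : W :=
  \sum_l gcoef l u *: b l.

Fact gunit_lift_linear (W : vectType k) b : linear (@gunit_lift_fun W b).
Proof.
move=> a u v; rewrite /gunit_lift_fun scaler_sumr -big_split.
by apply: eq_bigr => l _; rewrite linearP scalerDl scalerA.
Qed.

Definition gunit_lift (W : vectType k) b : 'Hom(gunit_space, W) :=
  lin_hom (@gunit_lift_linear W b).

Lemma gunit_lift_delta (W : vectType k) b l : q = 1%g -> @gunit_lift W b (gdelta l) = b l.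
Proof.
move=> q1; rewrite lin_homE /gunit_lift_fun (bigD1 l) //= big1 ?addr0 => [|l' neq_l].
  by rewrite gcoef_delta // eqxx scale1r.
by rewrite gcoef_delta // (negPf neq_l) scale0r.
Qed.

Definition gunit_act l : 'End(gunit_space) :=
  gunit_lift (fun l' => gdelta (l * l')%g).

Lemma gunit_actE l l' : gunit_act l (gdelta l') = gdelta (l * l')%g.
Proof.
case: (q =P 1%g) => [q1|neq_q1]; first exact: gunit_lift_delta.
by rewrite !gdelta0 ?linear0.
Qed.

Fact gunit_act1 : gunit_act 1%g = \1%VF.
Proof. by apply: gunit_ext => l q1; rewrite gunit_actE id_lfunE mul1g. Qed.

Fact gunit_actM l l' : gunit_act (l * l')%g = (gunit_act l \o gunit_act l')%VF.
Proof.
by apply: gunit_ext => x q1; rewrite comp_lfunE !gunit_actE mulgA.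
Qed.

End Component.

Arguments gdelta {q}.
Arguments gcoef {q}.
Arguments gunit_lift {q W}.

Definition gunit : graded k L Q := fun q => Rep (@gunit_act1 q) (@gunit_actM q).

Lemma gcoef_act q l l' (u : gunit q) :
  gcoef l (rep_act (gunit q) l' u) = gcoef (l'^-1 * l)%g u.
Proof.
rewrite -comp_lfunE; congr (fun_of_lfun _ u); apply: gunit_ext => x q1.
by rewrite comp_lfunE gunit_actE !gcoef_delta // eq_sym (canF_eq (mulKg l')) eq_sym.
Qed.

End Unit.

Arguments gunit {k L Q}.
Arguments gdelta {k L Q} q l.
Arguments gcoef {k L Q} q l.

(** * Functoriality and associativity *)

Section Structure.
Variables (k : fieldType) (L Q : finGroupType).
Variables (abL : abelian [set: L]) (alpha : actionByAut Q L).

Local Notation graded := (graded k L Q).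
Local Notation gten := (gten abL alpha).
Local Notation "x ⊠[ s ] y" := (gpure abL alpha s x y)
  (at level 45, format "x  ⊠[ s ]  y").

Section Map.
Variables (A A' B B' : graded).
Variables (f : forall q, rep_hom (A q) (A' q)) (g : forall q, rep_hom (B q) (B' q)).
Variable s : Q.

Fact gmap_balanced :
  gbalanced alpha (fun p q (m : A p) (n : B q) => f p m ⊠[s] g q n).
Proof.
move=> p q; split=> [n a u v|m a u v|l m n].
- by rewrite linearP gpure_linear_l.
- by rewrite [g q _]linearP gpure_linear_r.
by rewrite rep_homE gpure_act -rep_homE.
Qed.

Fact gmap_act p q l (m : A p) (n : B q) :
  f p (rep_act (A p) l m) ⊠[s] g q n = rep_act (gten A' B' s) l (f p m ⊠[s] g q n).
Proof. by rewrite gten_act_pure rep_homE. Qed.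

Definition gmap : rep_hom (gten A B s) (gten A' B' s) :=
  sval (gten_lift abL s gmap_balanced gmap_act).

Lemma gmapE p q (m : A p) (n : B q) : gmap (m ⊠[s] n) = f p m ⊠[s] g q n.
Proof.
have [def_s|neq_s] := (p * q)%g =P s; last by rewrite !gpure0 ?linear0.
exact: (svalP (gten_lift abL s gmap_balanced gmap_act)).
Qed.

End Map.

Lemma gmap1 (A B : graded) s :
  gmap (fun q => rep_id (A q)) (fun q => rep_id (B q)) s = rep_id _.
Proof. by apply: gten_rep_eq => p q m n _; rewrite gmapE !id_lfunE. Qed.

Lemma gmapM (A A' A'' B B' B'' : graded)
    (f' : forall q, rep_hom (A' q) (A'' q)) (f : forall q, rep_hom (A q) (A' q))
    (g' : forall q, rep_hom (B' q) (B'' q)) (g : forall q, rep_hom (B q) (B' q)) s :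
  gmap (fun q => rep_comp (f' q) (f q)) (fun q => rep_comp (g' q) (g q)) s
    = rep_comp (gmap f' g' s) (gmap f g s).
Proof.
by apply: gten_rep_eq => p q m n _; rewrite /= comp_lfunE !gmapE /= !comp_lfunE.
Qed.

Lemma gmap_linear_l (A A' B B' : graded) a
    (f f' : forall q, rep_hom (A q) (A' q)) (g : forall q, rep_hom (B q) (B' q)) s :
  gmap (fun q => a *: f q + f' q) g s = a *: gmap f g s + gmap f' g s.
Proof.
apply: gten_rep_eq => p q m n _.
by rewrite rep_hom_scaleD !gmapE rep_hom_scaleD gpure_linear_l.
Qed.

Lemma gmap_linear_r (A A' B B' : graded) a
    (f : forall q, rep_hom (A q) (A' q)) (g g' : forall q, rep_hom (B q) (B' q)) s :
  gmap f (fun q => a *: g q + g' q) s = a *: gmap f g s + gmap f g' s.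
Proof.
apply: gten_rep_eq => p q m n _.
by rewrite rep_hom_scaleD !gmapE rep_hom_scaleD gpure_linear_r.
Qed.

Section Assoc.
Variables A B C : graded.

Fact assoc_inner_balanced s q (c : C q) :
  gbalanced alpha (fun p1 p2 (a : A p1) (b : B p2) =>
    a ⊠[s] (b ⊠[p2 * q] c : gten B C _)).
Proof.
move=> p1 p2; split=> [b x u v|a x u v|l a b].
- exact: gpure_linear_l.
- by rewrite gpure_linear_l gpure_linear_r.
by rewrite gpure_act gten_act_pure.
Qed.

Definition assoc_fun s p q (x : gten A B p) (c : C q) : gten A (gten B C) s :=
  glift abL p (assoc_inner_balanced s c) x.

Lemma assoc_fun_linear s p q (c : C q) : linear (fun x => @assoc_fun s p q x c).
Proof. by move=> a u v; rewrite /assoc_fun linearP. Qed.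

Lemma assoc_funE s p q p1 p2 (a : A p1) (b : B p2) (c : C q) :
  (p1 * p2)%g = p ->
  assoc_fun s (a ⊠[p] b) c = a ⊠[s] (b ⊠[p2 * q] c : gten B C _).
Proof. by move=> def_p; apply: gliftE. Qed.

(** The twists match because passing [l] across an element of degree [p1] and
    then one of degree [p2] applies [alpha p2^-1] after [alpha p1^-1], which is
    [alpha (p1 * p2)^-1]. *)
Fact assoc_balanced s : gbalanced alpha (@assoc_fun s).
Proof.
move=> p q; split=> [c x u v|x a c c'|l x c].
- exact: assoc_fun_linear.
- move: x; apply: gten_eq => [y u v|y u v|p1 p2 m n def_p].
  + exact: assoc_fun_linear.
  + by rewrite !assoc_fun_linear !scalerDr !scalerA (mulrC a) addrACA.
  by rewrite !assoc_funE // !gpure_linear_r.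
move: x; apply: gten_eq => [y u v|y u v|p1 p2 m n def_p].
- by rewrite linearP assoc_fun_linear.
- exact: assoc_fun_linear.
rewrite gten_act_pure !assoc_funE // gpure_act gten_act_pure gpure_act.
by rewrite -aut_actM -invMg def_p.
Qed.

Fact assoc_act s p q l (x : gten A B p) (c : C q) :
  assoc_fun s (rep_act (gten A B p) l x) c
    = rep_act (gten A (gten B C) s) l (assoc_fun s x c).
Proof.
move: x; apply: gten_eq => [y u v|y u v|p1 p2 m n def_p].
- by rewrite linearP assoc_fun_linear.
- by rewrite assoc_fun_linear linearP.
by rewrite gten_act_pure !assoc_funE // gten_act_pure.
Qed.

Definition gassoc s : rep_hom (gten (gten A B) C s) (gten A (gten B C) s) :=
  sval (gten_lift abL s (@assoc_balanced s) (@assoc_act s)).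

Lemma gassocE s p q p1 p2 (a : A p1) (b : B p2) (c : C q) :
  (p1 * p2)%g = p -> (p * q)%g = s ->
  gassoc s ((a ⊠[p] b : gten A B _) ⊠[s] c) = a ⊠[s] (b ⊠[p2 * q] c : gten B C _).
Proof.
move=> def_p def_s; rewrite -(assoc_funE s a b c def_p).
exact: (svalP (gten_lift abL s (@assoc_balanced s) (@assoc_act s))).
Qed.

End Assoc.

Section AssocInverse.
Variables A B C : graded.

(** For fixed [a] an [l] acting on [b] is first moved onto [a], where it becomes
    [alpha p l], and then across all of a ⊗ b onto [c]. *)
Fact assoc_inv_inner_balanced s p (a : A p) :
  gbalanced alpha (fun q1 q2 (b : B q1) (c : C q2) =>
    (a ⊠[p * q1] b : gten A B _) ⊠[s] c).
Proof.
move=> q1 q2; split=> [c x u v|b x u v|l b c].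
- by rewrite gpure_linear_r gpure_linear_l.
- exact: gpure_linear_r.
rewrite gpure_shift_act -gten_act_pure gpure_act.
by rewrite invMg aut_actM aut_actK.
Qed.

Definition assoc_inv_fun s p q (a : A p) (y : gten B C q) : gten (gten A B) C s :=
  glift abL q (assoc_inv_inner_balanced s a) y.

Lemma assoc_inv_fun_linear s p q (a : A p) : linear (@assoc_inv_fun s p q a).
Proof. by move=> x u v; rewrite /assoc_inv_fun linearP. Qed.

Lemma assoc_inv_funE s p q q1 q2 (a : A p) (b : B q1) (c : C q2) :
  (q1 * q2)%g = q ->
  assoc_inv_fun s a (b ⊠[q] c) = (a ⊠[p * q1] b : gten A B _) ⊠[s] c.
Proof. by move=> def_q; apply: gliftE. Qed.

Fact assoc_inv_balanced s : gbalanced alpha (@assoc_inv_fun s).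
Proof.
move=> p q; split=> [y x a a'|a x u v|l a y].
- move: y; apply: gten_eq => [y u v|y u v|q1 q2 m n def_q].
  + exact: assoc_inv_fun_linear.
  + by rewrite !assoc_inv_fun_linear !scalerDr !scalerA (mulrC x) addrACA.
  by rewrite !assoc_inv_funE // !gpure_linear_l.
- exact: assoc_inv_fun_linear.
move: y; apply: gten_eq => [y u v|y u v|q1 q2 m n def_q].
- exact: assoc_inv_fun_linear.
- by rewrite twE linearP assoc_inv_fun_linear.
by rewrite twE gten_act_pure !assoc_inv_funE // gpure_act.
Qed.

Fact assoc_inv_act s p q l (a : A p) (y : gten B C q) :
  assoc_inv_fun s (rep_act (A p) l a) y
    = rep_act (gten (gten A B) C s) l (assoc_inv_fun s a y).
Proof.
move: y; apply: gten_eq => [y u v|y u v|q1 q2 m n def_p].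
- exact: assoc_inv_fun_linear.
- by rewrite assoc_inv_fun_linear linearP.
by rewrite !assoc_inv_funE // !gten_act_pure.
Qed.

Definition gassoc_inv s : rep_hom (gten A (gten B C) s) (gten (gten A B) C s) :=
  sval (gten_lift abL s (@assoc_inv_balanced s) (@assoc_inv_act s)).

Lemma gassoc_invE s p q q1 q2 (a : A p) (b : B q1) (c : C q2) :
  (q1 * q2)%g = q -> (p * q)%g = s ->
  gassoc_inv s (a ⊠[s] (b ⊠[q] c : gten B C _)) = (a ⊠[p * q1] b : gten A B _) ⊠[s] c.
Proof.
move=> def_q def_s; rewrite -(assoc_inv_funE s a b c def_q).
exact: (svalP (gten_lift abL s (@assoc_inv_balanced s) (@assoc_inv_act s))).
Qed.

End AssocInverse.

(** Morphisms out of an iterated tensor product agree once they agree on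
    iterated pure tensors; the inner degrees are products by definition, so
    that no equation on degrees remains to be solved. *)
Lemma gten3_eq (A B C : graded) s (N : rep k L)
    (f g : rep_hom (gten (gten A B) C s) N) :
  (forall p q r (a : A p) (b : B q) (c : C r), (p * q * r)%g = s ->
    f ((a ⊠[p * q] b : gten A B _) ⊠[s] c) = g ((a ⊠[p * q] b : gten A B _) ⊠[s] c)) ->
  f = g.
Proof.
move=> fg; apply: gten_rep_eq => p r x c def_s; move: x.
apply: gten_eq => [y u v|y u v|p1 p2 a b def_p]; try by rewrite gpure_linear_l linearP.
by subst p; apply: fg.
Qed.

Lemma gten3r_eq (A B C : graded) s (N : rep k L)
    (f g : rep_hom (gten A (gten B C) s) N) :
  (forall p q r (a : A p) (b : B q) (c : C r), (p * (q * r))%g = s ->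
    f (a ⊠[s] (b ⊠[q * r] c : gten B C _)) = g (a ⊠[s] (b ⊠[q * r] c : gten B C _))) ->
  f = g.
Proof.
move=> fg; apply: gten_rep_eq => p r a x def_s; move: x.
apply: gten_eq => [y u v|y u v|p1 p2 b c def_p]; try by rewrite gpure_linear_r linearP.
by subst r; apply: fg.
Qed.

Lemma gten4_eq (A B C D : graded) s (N : rep k L)
    (f g : rep_hom (gten (gten (gten A B) C) D s) N) :
  (forall p q r t (a : A p) (b : B q) (c : C r) (d : D t), (p * q * r * t)%g = s ->
    let x := ((a ⊠[p * q] b : gten A B _) ⊠[p * q * r] c : gten (gten A B) C _) in
    f (x ⊠[s] d) = g (x ⊠[s] d)) ->
  f = g.
Proof.
move=> fg; apply: gten3_eq => p r t x c d def_s; move: x.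
apply: gten_eq => [y u v|y u v|p1 p2 a b def_p];
  try by rewrite 2!gpure_linear_l linearP.
by subst p; apply: fg.
Qed.

Lemma gassocK (A B C : graded) s :
  rep_comp (gassoc_inv A B C s) (gassoc A B C s) = rep_id _.
Proof.
apply: gten3_eq => p q r a b c def_s.
by rewrite /= comp_lfunE id_lfunE gassocE // gassoc_invE // mulgA.
Qed.

Lemma gassoc_invK (A B C : graded) s :
  rep_comp (gassoc A B C s) (gassoc_inv A B C s) = rep_id _.
Proof.
apply: gten3r_eq => p q r a b c def_s.
by rewrite /= comp_lfunE id_lfunE gassoc_invE // gassocE // -mulgA.
Qed.

Lemma gassoc_nat (A A' B B' C C' : graded)
    (f : forall q, rep_hom (A q) (A' q)) (g : forall q, rep_hom (B q) (B' q))
    (h : forall q, rep_hom (C q) (C' q)) s :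
  rep_comp (gassoc A' B' C' s) (gmap (gmap f g) h s)
    = rep_comp (gmap f (gmap g h) s) (gassoc A B C s).
Proof.
apply: gten3_eq => p q r a b c def_s.
by rewrite /= !comp_lfunE gassocE // !gmapE gassocE.
Qed.

(** Both composites send ((a ⊗ b) ⊗ c) ⊗ d to a ⊗ (b ⊗ (c ⊗ d)); only the
    inner degrees are bracketed differently. *)
Lemma gpentagon (A B C D : graded) s :
  rep_comp (gassoc A B (gten C D) s) (gassoc (gten A B) C D s)
    = rep_comp (rep_comp (gmap (fun q => rep_id (A q)) (gassoc B C D) s)
                         (gassoc A (gten B C) D s))
               (gmap (gassoc A B C) (fun q => rep_id (D q)) s).
Proof.
apply: gten4_eq => p q r t a b c d def_s; rewrite /= !comp_lfunE.
rewrite gassocE // gassocE ?mulgA // gmapE gassocE // id_lfunE.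
by rewrite gassocE ?mulgA // gmapE id_lfunE gassocE.
Qed.

End Structure.

(** * Unitors *)

Section Unitors.
Variables (k : fieldType) (L Q : finGroupType).
Variables (abL : abelian [set: L]) (alpha : actionByAut Q L).

Local Notation graded := (graded k L Q).
Local Notation gten := (gten abL alpha).
Local Notation gassoc := (gassoc abL alpha).
Local Notation gmap := (gmap abL alpha).
Local Notation gunit := (@gunit k L Q).
Local Notation "x ⊠[ s ] y" := (gpure abL alpha s x y)
  (at level 45, format "x  ⊠[ s ]  y").

Lemma gunit_act_delta q l l' :
  rep_act (gunit q) l (gdelta q l') = gdelta q (l * l')%g.
Proof. exact: gunit_actE. Qed.

Lemma gunit_eq q (W : vectType k) (f g : gunit q -> W) :
  linear f -> linear g ->
  (forall l, q = 1%g -> f (gdelta q l) = g (gdelta q l)) -> f =1 g.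
Proof.
move=> f_lin g_lin fg x; rewrite -(lin_homE f_lin) -(lin_homE g_lin).
congr (fun_of_lfun _ x); apply: gunit_ext => l q1.
by rewrite !lin_homE fg.
Qed.

Section Object.
Variable A : graded.

Definition lunit_fun s p q (u : gunit p) (a : A q) : A s :=
  gunit_lift p (fun l => gcast A q s (rep_act (A q) l a)) u.

Lemma lunit_fun_linear s p q (a : A q) : linear (fun u => @lunit_fun s p q u a).
Proof. by move=> x u v; rewrite /lunit_fun linearP. Qed.

Lemma lunit_funE s p q l (a : A q) : p = 1%g ->
  lunit_fun s (gdelta p l) a = gcast A q s (rep_act (A q) l a).
Proof. by move=> p1; apply: gunit_lift_delta. Qed.

Fact lunit_balanced s : gbalanced alpha (@lunit_fun s).
Proof.
move=> p q; split=> [a x u v|u x a a'|l u a].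
- exact: lunit_fun_linear.
- move: u; apply: gunit_eq => [y u v|y u v|l p1].
  + exact: lunit_fun_linear.
  + by rewrite !lunit_fun_linear !scalerDr !scalerA (mulrC x) addrACA.
  by rewrite !lunit_funE // !linearP.
move: u; apply: gunit_eq => [y u v|y u v|l' p1].
- by rewrite linearP lunit_fun_linear.
- exact: lunit_fun_linear.
rewrite gunit_act_delta !lunit_funE // twE p1 invg1 aut_act1.
by rewrite (abelian_mulC abL) rep_actME.
Qed.

Fact lunit_act s p q l (u : gunit p) (a : A q) :
  lunit_fun s (rep_act (gunit p) l u) a = rep_act (A s) l (lunit_fun s u a).
Proof.
move: u; apply: gunit_eq => [y u v|y u v|l' p1].
- by rewrite linearP lunit_fun_linear.
- by rewrite lunit_fun_linear linearP.
by rewrite gunit_act_delta !lunit_funE // rep_actME rep_homE.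
Qed.

Definition glunit s : rep_hom (gten gunit A s) (A s) :=
  sval (gten_lift abL s (@lunit_balanced s) (@lunit_act s)).

Lemma glunitE s p q l (a : A q) : p = 1%g -> (p * q)%g = s ->
  glunit s ((gdelta p l : gunit p) ⊠[s] a) = gcast A q s (rep_act (A q) l a).
Proof.
move=> p1 def_s; rewrite -(lunit_funE s l a p1).
exact: (svalP (gten_lift abL s (@lunit_balanced s) (@lunit_act s))).
Qed.

(** A group element on the right of [a] in degree [p] acts on [a] through
    [alpha p], since the right factor is twisted by [p^-1]. *)
Definition runit_fun s p q (a : A p) (u : gunit q) : A s :=
  gunit_lift q (fun l => gcast A p s (rep_act (A p) (alpha p l) a)) u.

Lemma runit_fun_linear s p q (a : A p) : linear (@runit_fun s p q a).
Proof. by move=> x u v; rewrite /runit_fun linearP. Qed.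

Lemma runit_funE s p q l (a : A p) : q = 1%g ->
  runit_fun s a (gdelta q l) = gcast A p s (rep_act (A p) (alpha p l) a).
Proof. by move=> q1; apply: gunit_lift_delta. Qed.

Fact runit_balanced s : gbalanced alpha (@runit_fun s).
Proof.
move=> p q; split=> [u x a a'|a x u v|l a u].
- move: u; apply: gunit_eq => [y u v|y u v|l q1].
  + exact: runit_fun_linear.
  + by rewrite !runit_fun_linear !scalerDr !scalerA (mulrC x) addrACA.
  by rewrite !runit_funE // !linearP.
- exact: runit_fun_linear.
move: u; apply: gunit_eq => [y u v|y u v|l' q1].
- exact: runit_fun_linear.
- by rewrite twE linearP runit_fun_linear.
rewrite twE gunit_act_delta !runit_funE // aut_act_morph aut_actVK.
by rewrite (abelian_mulC abL) rep_actME.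
Qed.

Fact runit_act s p q l (a : A p) (u : gunit q) :
  runit_fun s (rep_act (A p) l a) u = rep_act (A s) l (runit_fun s a u).
Proof.
move: u; apply: gunit_eq => [y u v|y u v|l' q1].
- exact: runit_fun_linear.
- by rewrite runit_fun_linear linearP.
by rewrite !runit_funE // -rep_homE -!rep_actME (abelian_mulC abL).
Qed.

Definition grunit s : rep_hom (gten A gunit s) (A s) :=
  sval (gten_lift abL s (@runit_balanced s) (@runit_act s)).

Lemma grunitE s p q l (a : A p) : q = 1%g -> (p * q)%g = s ->
  grunit s (a ⊠[s] (gdelta q l : gunit q)) = gcast A p s (rep_act (A p) (alpha p l) a).
Proof.
move=> q1 def_s; rewrite -(runit_funE s l a q1).
exact: (svalP (gten_lift abL s (@runit_balanced s) (@runit_act s))).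
Qed.

Lemma gpure_castr (B : graded) s p q q' (b : B p) (a : A q) : q = q' ->
  b ⊠[s] gcast A q q' a = b ⊠[s] a.
Proof. by move=> e; subst q'; rewrite gcast_id. Qed.

Lemma gpure_castl (B : graded) s p p' q (a : A p) (b : B q) : p = p' ->
  gcast A p p' a ⊠[s] b = a ⊠[s] b.
Proof. by move=> e; subst p'; rewrite gcast_id. Qed.

(** The unit is generated by 1 as an L-module, so the tensors 1 ⊗ a suffice. *)
Lemma glunit_eq s (N : rep k L) (f g : rep_hom (gten gunit A s) N) :
  (forall a : A s, f ((gdelta 1 1%g : gunit 1%g) ⊠[s] a)
                     = g ((gdelta 1 1%g : gunit 1%g) ⊠[s] a)) ->
  f = g.
Proof.
move=> fg; apply: gten_rep_eq => p q u a def_s; move: u.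
apply: gunit_eq => [y u v|y u v|l p1]; try by rewrite gpure_linear_l linearP.
subst p; move: def_s; rewrite mul1g => def_q; subst q.
rewrite -[l in gdelta _ l]mulg1 -gunit_act_delta gpure_act.
exact: fg.
Qed.

Lemma grunit_eq s (N : rep k L) (f g : rep_hom (gten A gunit s) N) :
  (forall a : A s, f (a ⊠[s] (gdelta 1 1%g : gunit 1%g))
                     = g (a ⊠[s] (gdelta 1 1%g : gunit 1%g))) ->
  f = g.
Proof.
move=> fg; apply: gten_rep_eq => p q a u def_s; move: u.
apply: gunit_eq => [y u v|y u v|l q1]; try by rewrite gpure_linear_r linearP.
subst q; move: def_s; rewrite mulg1 => def_p; subst p.
rewrite -[l in gdelta _ l]mulg1 -gunit_act_delta gpure_shift_act.
exact: fg.
Qed.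

Fact lunit_inv_linear s :
  linear (fun a : A s => (gdelta 1 1%g : gunit 1%g) ⊠[s] a).
Proof. exact: gpure_linear_r. Qed.

Fact lunit_inv_act s l (a : A s) :
  lin_hom (@lunit_inv_linear s) (rep_act (A s) l a)
    = rep_act (gten gunit A s) l (lin_hom (@lunit_inv_linear s) a).
Proof. by rewrite !lin_homE gten_act_pure gpure_act invg1 aut_act1. Qed.

Definition glunit_inv s : rep_hom (A s) (gten gunit A s) :=
  mk_rep_hom (@lunit_inv_act s).

Fact runit_inv_linear s :
  linear (fun a : A s => a ⊠[s] (gdelta 1 1%g : gunit 1%g)).
Proof. exact: gpure_linear_l. Qed.

Fact runit_inv_act s l (a : A s) :
  lin_hom (@runit_inv_linear s) (rep_act (A s) l a)
    = rep_act (gten A gunit s) l (lin_hom (@runit_inv_linear s) a).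
Proof. by rewrite !lin_homE gten_act_pure. Qed.

Definition grunit_inv s : rep_hom (A s) (gten A gunit s) :=
  mk_rep_hom (@runit_inv_act s).

Lemma glunitK s : rep_comp (glunit_inv s) (glunit s) = rep_id _.
Proof.
apply: glunit_eq => a; rewrite /= comp_lfunE id_lfunE glunitE ?mul1g //.
by rewrite lin_homE rep_act1E gcast_id.
Qed.

Lemma glunit_invK s : rep_comp (glunit s) (glunit_inv s) = rep_id _.
Proof.
apply/rep_homP => a; rewrite /= comp_lfunE id_lfunE lin_homE glunitE ?mul1g //.
by rewrite rep_act1E gcast_id.
Qed.

Lemma alpha1 q : alpha q 1%g = 1%g.
Proof. by apply: (mulgI (alpha q 1%g)); rewrite -aut_act_morph !mulg1. Qed.

Lemma grunitK s : rep_comp (grunit_inv s) (grunit s) = rep_id _.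
Proof.
apply: grunit_eq => a; rewrite /= comp_lfunE id_lfunE grunitE ?mulg1 //.
by rewrite lin_homE alpha1 rep_act1E gcast_id.
Qed.

Lemma grunit_invK s : rep_comp (grunit s) (grunit_inv s) = rep_id _.
Proof.
apply/rep_homP => a; rewrite /= comp_lfunE id_lfunE lin_homE grunitE ?mulg1 //.
by rewrite alpha1 rep_act1E gcast_id.
Qed.

End Object.

Lemma glunit_nat (A B : graded) (f : forall q, rep_hom (A q) (B q)) s :
  rep_comp (glunit B s) (gmap (fun q => rep_id (gunit q)) f s)
    = rep_comp (f s) (glunit A s).
Proof.
apply: glunit_eq => a; rewrite /= !comp_lfunE gmapE id_lfunE !glunitE ?mul1g //.
by rewrite !rep_act1E !gcast_id.
Qed.

Lemma grunit_nat (A B : graded) (f : forall q, rep_hom (A q) (B q)) s :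
  rep_comp (grunit B s) (gmap f (fun q => rep_id (gunit q)) s)
    = rep_comp (f s) (grunit A s).
Proof.
apply: grunit_eq => a; rewrite /= !comp_lfunE gmapE id_lfunE !grunitE ?mulg1 //.
by rewrite !alpha1 !rep_act1E !gcast_id.
Qed.

(** On (a ⊗ l) ⊗ b this says that a ⊗ l b equals (alpha p l) a ⊗ b. *)
Lemma gtriangle (A B : graded) s :
  rep_comp (gmap (fun q => rep_id (A q)) (glunit B) s) (gassoc A gunit B s)
    = gmap (grunit A) (fun q => rep_id (B q)) s.
Proof.
apply: gten_rep_eq => p r x b def_s; move: x.
apply: gten_eq => [y u v|y u v|p1 p2 a u def_p];
  try by rewrite gpure_linear_l linearP.
move: u; apply: gunit_eq => [y u v|y u v|l p21];
  try by rewrite gpure_linear_r gpure_linear_l linearP.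
rewrite /= comp_lfunE gassocE // !gmapE !id_lfunE.
have r_eq : (r = p2 * r)%g by rewrite p21 mul1g.
have p_eq : p1 = p by rewrite -def_p p21 mulg1.
rewrite glunitE // grunitE // gpure_castr // gpure_castl //.
by rewrite gpure_shift_act.
Qed.

End Unitors.

(** * The right dual *)

Section Dual.
Variables (k : fieldType) (L Q : finGroupType).
Variables (abL : abelian [set: L]) (alpha : actionByAut Q L).

Local Notation graded := (graded k L Q).
Local Notation gten := (gten abL alpha).
Local Notation gmap := (gmap abL alpha).
Local Notation gunit := (@gunit k L Q).
Local Notation "x ⊠[ s ] y" := (gpure abL alpha s x y)
  (at level 45, format "x  ⊠[ s ]  y").

Definition gdual (A : graded) : graded :=
  fun q => dual_rep abL (tw alpha q^-1%g (A q^-1%g)).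

(** Evaluation of a form in the dual, with the spaces of [A] instead of their
    twists in its type. *)
Definition gev (A : graded) q (u : gdual A q) : A q^-1%g -> k^o :=
  fun_of_lfun (u : 'Hom(A q^-1%g, k^o)).

Lemma gev_linear A q (u : gdual A q) : linear (gev u).
Proof. exact: linearP. Qed.

Lemma gev_linear_l A q a (u v : gdual A q) x :
  gev (a *: u + v) x = a *: gev u x + gev v x.
Proof. by rewrite /gev add_lfunE scale_lfunE. Qed.

Lemma gev_act A q l (u : gdual A q) x :
  gev (rep_act (gdual A q) l u) x = gev u (rep_act (A q^-1%g) (alpha q^-1%g l) x).
Proof. by rewrite /gev /= transposeE comp_lfunE. Qed.

Lemma gev_inj A q (u v : gdual A q) : gev u =1 gev v -> u = v.
Proof. by move=> uv; apply/lfunP. Qed.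

Definition gdual_map (A B : graded) (f : forall q, rep_hom (A q) (B q)) q :
    rep_hom (gdual B q) (gdual A q) :=
  dual_map abL (twist_map (aut_act_morph alpha q^-1%g) (f q^-1%g)).

Lemma gev_map (A B : graded) (f : forall q, rep_hom (A q) (B q)) q u x :
  gev (gdual_map f q u) x = gev u (f q^-1%g x).
Proof. by rewrite /gev /= transposeE comp_lfunE. Qed.

Section Adjunction.
Variables A B : graded.

(** A morphism [h] into the unit is recovered from its coefficient at 1, as the
    coefficient of [h x] at [l] is the one of [h (l^-1 x)] at 1. So morphisms
    A ⊗ B -> 1 correspond to linear forms on the component of degree 1, and these
    to morphisms B -> D A. *)
Section Curry.
Variable h : forall s, rep_hom (gten A B s) (gunit s).
Variable q : Q.

Definition curry_form (b : B q) (a : A q^-1%g) : k^o :=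
  gcoef 1 1%g (h 1%g (a ⊠[1%g] b)).

Fact curry_form_linear b : linear (curry_form b).
Proof. by move=> x u v; rewrite /curry_form gpure_linear_l !linearP. Qed.

Definition curry_fun (b : B q) : gdual A q := lin_hom (@curry_form_linear b).

Lemma gev_curry_fun b a : gev (curry_fun b) a = curry_form b a.
Proof. exact: lin_homE. Qed.

Fact curry_fun_linear : linear curry_fun.
Proof.
move=> x b b'; apply: gev_inj => a; rewrite gev_linear_l !gev_curry_fun.
by rewrite /curry_form gpure_linear_r !linearP.
Qed.

Fact curry_act l b :
  lin_hom curry_fun_linear (rep_act (B q) l b)
    = rep_act (gdual A q) l (lin_hom curry_fun_linear b).
Proof.
apply: gev_inj => a; rewrite gev_act !lin_homE !gev_curry_fun.
by rewrite /curry_form gpure_shift_act.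
Qed.

Definition curry : rep_hom (B q) (gdual A q) := mk_rep_hom curry_act.

Lemma gev_curry b a : gev (curry b) a = gcoef 1 1%g (h 1%g (a ⊠[1%g] b)).
Proof. by rewrite /= lin_homE gev_curry_fun. Qed.

End Curry.

Section Uncurry.
Variable phi : forall q, rep_hom (B q) (gdual A q).
Variable s : Q.

Definition uncurry_fun p q (a : A p) (b : B q) : gunit s :=
  \sum_l (gev (phi q b) (gcast A p q^-1%g (rep_act (A p) l^-1%g a)) : k)
    *: (gdelta s l : gunit s).

Fact uncurry_balanced : gbalanced alpha uncurry_fun.
Proof.
move=> p q; split=> [b x a a'|a x b b'|l a b]; rewrite /uncurry_fun.
- rewrite scaler_sumr -big_split; apply: eq_bigr => l _ /=.
  by rewrite !linearP gev_linear scalerDl scalerA.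
- rewrite scaler_sumr -big_split; apply: eq_bigr => l _ /=.
  by rewrite linearP gev_linear_l scalerDl scalerA.
apply: eq_bigr => l' _; congr (_ *: _).
rewrite twE (rep_homE (phi q)) gev_act; case: (p =P q^-1%g) => [e|neq_p]; last first.
  by rewrite !gcast0 // linear0.
subst p; rewrite invgK aut_actK -rep_homE -!rep_actME.
by rewrite (abelian_mulC abL).
Qed.

Fact uncurry_act p q l (a : A p) (b : B q) :
  uncurry_fun (rep_act (A p) l a) b = rep_act (gunit s) l (uncurry_fun a b).
Proof.
(* Substituting [l * l'] for the summation index absorbs the action. *)
rewrite /uncurry_fun linear_sum (reindex_inj (mulgI l)) /=.
apply: eq_bigr => l' _; rewrite linearZ -gunit_act_delta; congr (_ *: _).
by rewrite -rep_actME invMg mulgKV.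
Qed.

Definition uncurry : rep_hom (gten A B s) (gunit s) :=
  sval (gten_lift abL s uncurry_balanced uncurry_act).

Lemma uncurryE p q (a : A p) (b : B q) : (p * q)%g = s ->
  uncurry (a ⊠[s] b) = uncurry_fun a b.
Proof. exact: (svalP (gten_lift abL s uncurry_balanced uncurry_act)). Qed.

End Uncurry.

(** Off degree 1 the unit vanishes, and in degree 1 the sum defining [uncurry]
    is the expansion of [h (a ⊗ b)] in the basis of group elements. *)
Lemma curryK h s : uncurry (curry h) s = h s.
Proof.
apply: gten_rep_eq => p q a b def_s; rewrite uncurryE // /uncurry_fun.
case: (s =P 1%g) => [s1|neq_s]; last first.
  by rewrite [RHS]gcoef_sum; apply: eq_bigr => l _; rewrite gdelta0 // !scaler0.
have p_eq : p = q^-1%g by apply/eqP; rewrite eq_mulgV1 invgK def_s s1.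
clear def_s; subst s.
rewrite [RHS]gcoef_sum; apply: eq_bigr => l _; congr (_ *: _).
by subst p; rewrite gev_curry gcast_id -gten_act_pure rep_homE gcoef_act invgK mulg1.
Qed.

Lemma uncurryK phi q : curry (uncurry phi) q = phi q.
Proof.
apply/rep_homP => b; apply: gev_inj => a.
rewrite gev_curry uncurryE ?mulVg // /uncurry_fun linear_sum /=.
rewrite (bigD1 1%g) //= big1 ?addr0 => [|l neq_l1].
  rewrite linearZ /= gcoef_delta // eqxx invg1 rep_act1E gcast_id.
  exact: mulr1.
by rewrite linearZ /= gcoef_delta // eq_sym (negPf neq_l1) scaler0.
Qed.

End Adjunction.

Lemma curry_nat_r (A B B' : graded) (f : forall q, rep_hom (B' q) (B q))
    (h : forall s, rep_hom (gten A B s) (gunit s)) q :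
  curry (fun s => rep_comp (h s) (gmap (fun p => rep_id (A p)) f s)) q
    = rep_comp (curry h q) (f q).
Proof.
apply/rep_homP => b; apply: gev_inj => a.
by rewrite gev_curry /= !comp_lfunE gmapE id_lfunE -gev_curry.
Qed.

Lemma curry_nat_l (A A' B : graded) (f : forall q, rep_hom (A' q) (A q))
    (h : forall s, rep_hom (gten A B s) (gunit s)) q :
  curry (fun s => rep_comp (h s) (gmap f (fun p => rep_id (B p)) s)) q
    = rep_comp (gdual_map f q) (curry h q).
Proof.
apply/rep_homP => b; apply: gev_inj => a.
rewrite gev_curry [in RHS]comp_lfunE gev_map gev_curry.
by rewrite /= comp_lfunE gmapE id_lfunE.
Qed.

(** The canonical map from a space to its bidual; both twists cancel because
    [alpha q^-1] and [alpha q] are inverse to each other. *)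
Section DoubleDual.
Variables (A : graded) (q : Q).

Let r := q^-1^-1%g.

Definition ddual_form (a : A q) (u : gdual A q^-1%g) : k^o := gev u (gcast A q r a).

Fact ddual_form_linear a : linear (ddual_form a).
Proof. by move=> x u v; rewrite /ddual_form gev_linear_l. Qed.

Definition ddual_fun (a : A q) : gdual (gdual A) q := lin_hom (@ddual_form_linear a).

Lemma gev_ddual_fun a u : gev (ddual_fun a) u = gev u (gcast A q r a).
Proof. exact: lin_homE. Qed.

Fact ddual_fun_linear : linear ddual_fun.
Proof.
move=> x a b; apply: gev_inj => u.
by rewrite gev_linear_l !gev_ddual_fun linearP gev_linear.
Qed.

Fact ddual_act l a :
  lin_hom ddual_fun_linear (rep_act (A q) l a)
    = rep_act (gdual (gdual A) q) l (lin_hom ddual_fun_linear a).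
Proof.
apply: gev_inj => u; rewrite !(lin_homE ddual_fun_linear) gev_act.
rewrite !gev_ddual_fun gev_act.
by rewrite rep_homE aut_actK.
Qed.

Definition ddual : rep_hom (A q) (gdual (gdual A) q) := mk_rep_hom ddual_act.

Lemma gev_ddual a u : gev (ddual a) u = gev u (gcast A q r a).
Proof. by rewrite /= lin_homE gev_ddual_fun. Qed.

End DoubleDual.

Fact coordinate_linear (V : vectType k) i : linear (fun v : V => v2r v 0 i : k^o).
Proof. by move=> x u v; rewrite linearP !mxE. Qed.

Lemma ddual_inj A q : lker (ddual A q) == 0%VS.
Proof.
apply/lker0P => a b eq_ab.
have q_eq : q = q^-1^-1%g by rewrite invgK.
have castK (c : A q) : gcast A _ q (gcast A q q^-1^-1%g c) = c.
  by rewrite -[in RHS](gcast_id c); case: _ / q_eq; rewrite !gcast_id.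
rewrite -[a]castK -[b]castK; congr (gcast A _ q _); apply: v2r_inj.
apply/rowP=> i; pose u := lin_hom (@coordinate_linear (A q^-1^-1%g) i).
have := congr1 (fun x : gdual (gdual A) q => gev x u) eq_ab.
by rewrite !gev_ddual /gev !lin_homE.
Qed.

Lemma dim_gdual (A : graded) q : dim (gdual A q) = dim (A q^-1%g).
Proof. exact: muln1. Qed.

Lemma dim_ddual (A : graded) q : dim (A q) = dim (gdual (gdual A) q).
Proof. by rewrite !dim_gdual invgK. Qed.

Lemma ddual_nat (A B : graded) (f : forall q, rep_hom (A q) (B q)) q :
  rep_comp (ddual B q) (f q) = rep_comp (gdual_map (gdual_map f) q) (ddual A q).
Proof.
apply/rep_homP => a; apply: gev_inj => u.
rewrite [in RHS]comp_lfunE gev_map !gev_ddual gev_map.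
by rewrite /= comp_lfunE gev_ddual gcast_nat.
Qed.

Lemma gdual_map1 A q : gdual_map (fun p => rep_id (A p)) q = rep_id _.
Proof. by apply/rep_homP => u; apply: gev_inj => x; rewrite gev_map !id_lfunE. Qed.

Lemma gdual_mapM (A B C : graded) (g : forall q, rep_hom (B q) (C q))
    (f : forall q, rep_hom (A q) (B q)) q :
  gdual_map (fun p => rep_comp (g p) (f p)) q
    = rep_comp (gdual_map f q) (gdual_map g q).
Proof.
apply/rep_homP => u; apply: gev_inj => x.
by rewrite [in RHS]comp_lfunE !gev_map [in LHS]comp_lfunE.
Qed.

Lemma gdual_map_linear (A B : graded) a (f g : forall q, rep_hom (A q) (B q)) q :
  gdual_map (fun p => a *: f p + g p) q = a *: gdual_map f q + gdual_map g q.
Proof.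
apply/rep_homP => u; apply: gev_inj => x.
by rewrite rep_hom_scaleD gev_linear_l !gev_map rep_hom_scaleD gev_linear.
Qed.

End Dual.

(** * Homogeneous objects *)

Section Homogeneous.
Variables (k : fieldType) (L Q : finGroupType).
Variables (abL : abelian [set: L]) (alpha : actionByAut Q L).

Local Notation graded := (graded k L Q).
Local Notation gten := (gten abL alpha).
Local Notation gmap := (gmap abL alpha).
Local Notation gdual := (gdual abL alpha).
Local Notation tw := (tw alpha).
Local Notation "x ⊠[ s ] y" := (gpure abL alpha s x y)
  (at level 45, format "x  ⊠[ s ]  y").

Lemma zero_rep_eq0 (x : zero_rep k L) : x = 0.
Proof. by apply: val_inj; apply/eqP; rewrite -memv0 subvsP. Qed.

(** [M] placed in degree [p]: the object [homog_obj], and below it the map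
    [homog_map], for an arbitrary grading group. *)
Definition conc (p : Q) (M : rep k L) : graded :=
  fun q => if q == p then M else zero_rep k L.

Definition conc_map p (M N : rep k L) (f : rep_hom M N) q :
    rep_hom (conc p M q) (conc p N q) :=
  if q == p as b return rep_hom (if b then M else zero_rep k L)
                                (if b then N else zero_rep k L)
  then f else rep_id (zero_rep k L).

Definition conc_in p (M : rep k L) q : rep_hom M (conc p M q) :=
  if q == p as b return rep_hom M (if b then M else zero_rep k L)
  then rep_id M else 0.

Definition conc_out p (M : rep k L) q : rep_hom (conc p M q) M :=
  if q == p as b return rep_hom (if b then M else zero_rep k L) M
  then rep_id M else 0.

Lemma conc_eq0 p M q (x : conc p M q) : q <> p -> x = 0.
Proof.
move=> /eqP neq_qp; move: x; rewrite /conc (negPf neq_qp); exact: zero_rep_eq0.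
Qed.

Lemma conc_outK p M q (x : conc p M q) : conc_in p M q (conc_out p M q x) = x.
Proof.
move: x; rewrite /conc_in /conc_out /conc; case: (q == p) => x /=.
  by rewrite !id_lfunE.
by rewrite [RHS]zero_rep_eq0 zero_lfunE.
Qed.

Lemma conc_inK p M m : conc_out p M p (conc_in p M p m) = m.
Proof. by rewrite /conc_in /conc_out /conc eqxx /= !id_lfunE. Qed.

Lemma conc_map_in p M N (f : rep_hom M N) q m :
  conc_map p f q (conc_in p M q m) = conc_in p N q (f m).
Proof.
rewrite /conc_map /conc_in /conc; case: (q == p) => /=; first by rewrite !id_lfunE.
by rewrite !zero_lfunE linear0.
Qed.

Lemma conc_map_out p M N (f : rep_hom M N) q x :
  conc_out p N q (conc_map p f q x) = f (conc_out p M q x).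
Proof.
move: x; rewrite /conc_map /conc_out /conc; case: (q == p) => x /=.
  by rewrite !id_lfunE.
by rewrite !zero_lfunE linear0.
Qed.

Section Tensor.
Variables (p q : Q) (M N : rep k L).

Let MN : rep k L := ten_rep abL M (tw p^-1%g N).
Let pureMN (m : M) (n : N) : MN := @pure k L M (tw p^-1%g N) m n.

Lemma pureMN_act l m n : rep_act MN l (pureMN m n) = pureMN (rep_act M l m) n.
Proof. exact: ten_actE. Qed.

(** In degrees other than [p * q] the target of [conc_in] is zero, so this formula
    is correct for all [s]. *)
Definition conc_ten_fun s p' q' (m : conc p M p') (n : conc q N q') :
    conc (p * q)%g MN s :=
  conc_in (p * q)%g MN s (pureMN (conc_out p M p' m) (conc_out q N q' n)).

Fact conc_ten_balanced s : gbalanced alpha (@conc_ten_fun s).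
Proof.
have [pl pr pL] := pure_balanced M (tw p^-1%g N).
move=> p' q'; split=> [n a u v|m a u v|l m n]; rewrite /conc_ten_fun /pureMN.
- by rewrite linearP pl linearP.
- by rewrite [conc_out q N q' _]linearP pr linearP.
case: (p' =P p) => [e|neq_p]; last first.
  by rewrite (conc_eq0 m neq_p) !linear0 !(linear_fun0 (pl _)).
by subst p'; rewrite twE !rep_homE pL.
Qed.

Fact conc_ten_act s p' q' l (m : conc p M p') (n : conc q N q') :
  conc_ten_fun s (rep_act _ l m) n
    = rep_act (conc (p * q)%g MN s) l (conc_ten_fun s m n).
Proof.
by rewrite /conc_ten_fun rep_homE -pureMN_act rep_homE.
Qed.

Definition conc_ten s : rep_hom (gten (conc p M) (conc q N) s) (conc (p * q)%g MN s) :=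
  sval (gten_lift abL s (@conc_ten_balanced s) (@conc_ten_act s)).

Lemma conc_tenE s p' q' (m : conc p M p') (n : conc q N q') : (p' * q')%g = s ->
  conc_ten s (m ⊠[s] n)
    = conc_in (p * q)%g MN s (pureMN (conc_out p M p' m) (conc_out q N q' n)).
Proof. exact: (svalP (gten_lift abL s (@conc_ten_balanced s) (@conc_ten_act s))). Qed.

Definition conc_ten_inv_fun s (m : M) (n : N) : gten (conc p M) (conc q N) s :=
  conc_in p M p m ⊠[s] conc_in q N q n.

Fact conc_ten_inv_balanced s :
  @balanced k L M (tw p^-1%g N) _ (@conc_ten_inv_fun s).
Proof.
split=> [n a u v|m a u v|l m n]; rewrite /conc_ten_inv_fun.
- by rewrite linearP gpure_linear_l.
- by rewrite [conc_in q N q _]linearP gpure_linear_r.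
by rewrite twE !rep_homE gpure_act.
Qed.

Definition conc_ten_inv_lfun s : 'Hom(MN, gten (conc p M) (conc q N) s) :=
  @ten_lift k L M (tw p^-1%g N) _ (@conc_ten_inv_fun s).

Lemma conc_ten_inv_lfunE s m n :
  conc_ten_inv_lfun s (pureMN m n) = conc_in p M p m ⊠[s] conc_in q N q n.
Proof. exact: (ten_liftE _ _ (conc_ten_inv_balanced s)). Qed.

Fact conc_ten_inv_act s l x :
  (conc_ten_inv_lfun s \o conc_out (p * q)%g MN s)%VF (rep_act _ l x)
    = rep_act (gten (conc p M) (conc q N) s) l
        ((conc_ten_inv_lfun s \o conc_out (p * q)%g MN s)%VF x).
Proof.
rewrite !comp_lfunE rep_homE; move: (conc_out _ _ _ x) => y.
rewrite -!comp_lfunE; congr (fun_of_lfun _ y); apply: pure_ext => m n.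
rewrite !comp_lfunE -/(pureMN m n) pureMN_act !conc_ten_inv_lfunE rep_homE.
by rewrite gten_act_pure.
Qed.

Definition conc_ten_inv s : rep_hom (conc (p * q)%g MN s) (gten (conc p M) (conc q N) s) :=
  mk_rep_hom (@conc_ten_inv_act s).

Lemma conc_ten_invE s m n : s = (p * q)%g ->
  conc_ten_inv s (conc_in (p * q)%g MN s (pureMN m n))
    = conc_in p M p m ⊠[s] conc_in q N q n.
Proof. by move=> ->; rewrite /= comp_lfunE conc_inK conc_ten_inv_lfunE. Qed.

Lemma conc_tenK s : rep_comp (conc_ten_inv s) (conc_ten s) = rep_id _.
Proof.
apply: gten_rep_eq => p' q' m n def_s; rewrite [LHS]comp_lfunE id_lfunE.
case: (p' =P p) => [e|neq_p]; last by rewrite (conc_eq0 m neq_p) gpure0l !linear0.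
case: (q' =P q) => [e'|neq_q]; last by rewrite (conc_eq0 n neq_q) gpure0r !linear0.
subst p' q'; rewrite conc_tenE // conc_ten_invE //.
by rewrite !conc_outK.
Qed.

Lemma conc_ten_invK s : rep_comp (conc_ten s) (conc_ten_inv s) = rep_id _.
Proof.
apply/rep_homP => x; rewrite [LHS]comp_lfunE id_lfunE.
case: (s =P (p * q)%g) => [e|neq_s]; last by rewrite (conc_eq0 x neq_s) !linear0.
rewrite -[x]conc_outK; move: (conc_out _ _ _ x) => y.
rewrite -!comp_lfunE; congr (fun_of_lfun _ y); apply: pure_ext => m n.
rewrite [LHS]comp_lfunE [LHS]comp_lfunE -/(pureMN m n) conc_ten_invE // conc_tenE //.
by rewrite !conc_inK.
Qed.

End Tensor.

Lemma conc_ten_nat p q (M M' N N' : rep k L) (f : rep_hom M M') (g : rep_hom N N') s :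
  rep_comp (conc_ten p q M' N' s) (gmap (conc_map p f) (conc_map q g) s)
    = rep_comp
        (conc_map (p * q)%g (ten_map abL f (twist_map (aut_act_morph alpha p^-1%g) g)) s)
        (conc_ten p q M N s).
Proof.
apply: gten_rep_eq => p' q' m n def_s.
rewrite [LHS]comp_lfunE [RHS]comp_lfunE gmapE !conc_tenE // conc_map_in /=.
by rewrite ten_lfunE !conc_map_out.
Qed.

Section Dual.
Variables (p : Q) (M : rep k L).

Let DM : rep k L := dual_rep abL (tw p M).

Definition conc_dual_form q (u : gdual (conc p M) q) (m : M) : k^o :=
  gev u (conc_in p M q^-1%g m).

Fact conc_dual_form_linear q u : linear (@conc_dual_form q u).
Proof. by move=> a x y; rewrite /conc_dual_form linearP gev_linear. Qed.

Definition conc_dual_fun q (u : gdual (conc p M) q) : DM :=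
  lin_hom (@conc_dual_form_linear q u).

Lemma conc_dual_funE q u m :
  fun_of_lfun (@conc_dual_fun q u : 'Hom(M, k^o)) m = gev u (conc_in p M q^-1%g m).
Proof. exact: lin_homE. Qed.

Lemma dual_tw_act l (v : DM) m :
  fun_of_lfun (rep_act DM l v : 'Hom(M, k^o)) m
    = fun_of_lfun (v : 'Hom(M, k^o)) (rep_act M (alpha p l) m).
Proof. by rewrite /= transposeE comp_lfunE. Qed.

Fact conc_dual_fun_linear q : linear (@conc_dual_fun q).
Proof.
move=> a u v; apply/lfunP=> m.
by rewrite add_lfunE scale_lfunE !conc_dual_funE gev_linear_l.
Qed.

Fact conc_dual_act q l u :
  (conc_in p^-1%g DM q \o lin_hom (@conc_dual_fun_linear q))%VF (rep_act _ l u)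
    = rep_act (conc p^-1%g DM q) l
        ((conc_in p^-1%g DM q \o lin_hom (@conc_dual_fun_linear q))%VF u).
Proof.
rewrite !comp_lfunE -rep_homE !(lin_homE (@conc_dual_fun_linear q)).
case: (q =P p^-1%g) => [e|neq_q]; last first.
  by rewrite [LHS](conc_eq0 _ neq_q) [RHS](conc_eq0 _ neq_q).
congr (conc_in _ _ _ _); apply/lfunP=> m.
rewrite [RHS]dual_tw_act !conc_dual_funE gev_act.
by rewrite rep_homE (_ : alpha q^-1%g l = alpha p l) // e invgK.
Qed.

Definition conc_dual q : rep_hom (gdual (conc p M) q) (conc p^-1%g DM q) :=
  mk_rep_hom (@conc_dual_act q).

Lemma conc_dualE q u : conc_dual q u = conc_in p^-1%g DM q (conc_dual_fun u).
Proof. by rewrite /= comp_lfunE (lin_homE (@conc_dual_fun_linear q)). Qed.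

(** Together with equality of dimensions this makes [conc_dual] invertible, which
    spares writing down its inverse. *)
Lemma conc_dual_inj q : lker (conc_dual q) == 0%VS.
Proof.
apply/lker0P => u v eq_uv; apply: gev_inj => x.
case: (q =P p^-1%g) => [e|neq_q]; last first.
  have x0 : x = 0 by apply: conc_eq0 => e; apply: neq_q; rewrite -e invgK.
  by rewrite x0 /gev !linear0.
subst q; move: eq_uv; rewrite !conc_dualE => /(congr1 (conc_out _ _ _)).
rewrite !conc_inK => /lfunP/(_ (conc_out _ _ _ x)).
by rewrite !conc_dual_funE conc_outK.
Qed.

Lemma dim_conc_dual q : dim (gdual (conc p M) q) = dim (conc p^-1%g DM q).
Proof.
rewrite dim_gdual /conc -(inj_eq invg_inj) invgK.
case: (q == p^-1%g) => //; exact: (esym (muln1 _)).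
Qed.

End Dual.

Lemma dual_tw_map p (M N : rep k L) (f : rep_hom M N) (v : dual_rep abL (tw p N)) m :
  fun_of_lfun (dual_map abL (twist_map (aut_act_morph alpha p) f) v : 'Hom(M, k^o)) m
    = fun_of_lfun (v : 'Hom(N, k^o)) (f m).
Proof. by rewrite /= transposeE comp_lfunE. Qed.

Lemma conc_dual_nat p (M N : rep k L) (f : rep_hom M N) q :
  rep_comp (conc_dual p M q) (gdual_map abL alpha (conc_map p f) q)
    = rep_comp
        (conc_map p^-1%g (dual_map abL (twist_map (aut_act_morph alpha p) f)) q)
        (conc_dual p N q).
Proof.
apply/rep_homP => u; rewrite [LHS]comp_lfunE [RHS]comp_lfunE !conc_dualE conc_map_in.
congr (conc_in _ _ _ _); apply/lfunP=> m.
rewrite [RHS](dual_tw_map f) [LHS](@conc_dual_funE p M) [RHS](@conc_dual_funE p N).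
by rewrite gev_map conc_map_in.
Qed.

End Homogeneous.

(** * The right r-category of graded representations *)

Section Assembly.
Variables (k : fieldType) (G H : finGroupType) (X : crossed_module G H).

Let L := cm_L X.
Let Q := cm_Q X.
Let abL : abelian [set: L] := cm_L_abelian X.
Let alpha : actionByAut Q L := cm_actionByAut X.
Let C : category := RepG k X.

Lemma RepG_iso (A B : C) (f : Defs.hom A B) (g : Defs.hom B A) :
  (forall s, rep_comp (g s) (f s) = rep_id _) ->
  (forall s, rep_comp (f s) (g s) = rep_id _) -> is_iso f.
Proof.
by move=> fK gK; exists g; split; apply: functional_extensionality_dep.
Qed.

Definition RepG_tensor_map (AB AB' : prod_cat C C) (f : Defs.hom AB AB') :
  @Defs.hom C (gten abL alpha AB.1 AB.2) (gten abL alpha AB'.1 AB'.2) :=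
  gmap abL alpha f.1 f.2.

Fact RepG_tensor_map1 AB : RepG_tensor_map (Defs.idm AB) = Defs.idm _.
Proof. by apply: functional_extensionality_dep => s; apply: gmap1. Qed.

Fact RepG_tensor_mapM AB AB' AB'' (g : Defs.hom AB' AB'') (f : Defs.hom AB AB') :
  RepG_tensor_map (g ∘ f) = RepG_tensor_map g ∘ RepG_tensor_map f.
Proof. by apply: functional_extensionality_dep => s; apply: gmapM. Qed.

Definition RepG_tensor : functor (prod_cat C C) C :=
  Functor RepG_tensor_map1 RepG_tensor_mapM.

Fact RepG_assoc_iso (A B D : C) :
  @is_iso C _ _ (gassoc abL alpha A B D).
Proof. exact: (RepG_iso (gassocK _ _ A B D) (gassoc_invK _ _ A B D)). Qed.

Fact RepG_lunit_iso (A : C) : @is_iso C _ _ (glunit abL alpha A).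
Proof. exact: (RepG_iso (glunitK _ _ A) (glunit_invK _ _ A)). Qed.

Fact RepG_runit_iso (A : C) : @is_iso C _ _ (grunit abL alpha A).
Proof. exact: (RepG_iso (grunitK _ _ A) (grunit_invK _ _ A)). Qed.

Definition RepG_monoidal : monoidal C.
Proof.
apply: (@Monoidal C RepG_tensor (gunit : gobj k X)
  (gassoc abL alpha) (glunit abL alpha) (grunit abL alpha)
  RepG_assoc_iso RepG_lunit_iso RepG_runit_iso).
- by move=> *; apply: functional_extensionality_dep => s; apply: gassoc_nat.
- by move=> *; apply: functional_extensionality_dep => s; apply: glunit_nat.
- by move=> *; apply: functional_extensionality_dep => s; apply: grunit_nat.
- by move=> *; apply: functional_extensionality_dep => s; apply: gpentagon.
by move=> *; apply: functional_extensionality_dep => s; apply: gtriangle.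
Defined.

Fact RepG_dual_map1 (A : C) :
  gdual_map abL alpha (Defs.idm A) = @Defs.idm C (gdual abL alpha A).
Proof. by apply: functional_extensionality_dep => s; apply: gdual_map1. Qed.

Fact RepG_dual_mapM (A B D : C) (g : Defs.hom B D) (f : Defs.hom A B) :
  gdual_map abL alpha (g ∘ f)
    = @cmp C (gdual abL alpha D) (gdual abL alpha B) (gdual abL alpha A)
        (gdual_map abL alpha f) (gdual_map abL alpha g).
Proof. by apply: functional_extensionality_dep => s; apply: gdual_mapM. Qed.

Definition RepG_dual : functor (op_cat C) C :=
  @Functor (op_cat C) C (gdual abL alpha) (fun A B f => gdual_map abL alpha f)
    RepG_dual_map1 (fun A B D g f => RepG_dual_mapM f g).

(** The same assignment as [RepG_dual], read as a functor to the opposite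
    category; it is the quasi-inverse of [RepG_dual]. *)
Definition RepG_codual : functor C (op_cat C) :=
  @Functor C (op_cat C) (gdual abL alpha) (fun A B f => gdual_map abL alpha f)
    RepG_dual_map1 RepG_dual_mapM.

Lemma RepG_dualP : is_right_dualising RepG_monoidal RepG_dual.
Proof.
exists (fun A B h => curry h); split.
- move=> A B; exists (fun phi => uncurry phi) => h.
    by apply: functional_extensionality_dep => s; apply: curryK.
  by apply: functional_extensionality_dep => s; apply: uncurryK.
- by move=> *; apply: functional_extensionality_dep => s; apply: curry_nat_r.
by move=> *; apply: functional_extensionality_dep => s; apply: curry_nat_l.
Qed.

(** Both natural isomorphisms are the comparison with the bidual, once directly
    and once inverted. *)
Lemma RepG_dual_equiv : is_equivalence RepG_dual.
Proof.
pose inv (A : C) s := rep_iso_inv (ddual_inj abL alpha A s) (dim_ddual abL alpha A s).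
have invl A s : rep_comp (sval (inv A s)) (ddual abL alpha A s) = rep_id _.
  by case: (inv A s) => g [].
have invr A s : rep_comp (ddual abL alpha A s) (sval (inv A s)) = rep_id _.
  by case: (inv A s) => g [].
exists RepG_codual; split.
  exists (fun A => ddual abL alpha A); split=> [A|A B f].
    exists (fun s => sval (inv A s)).
    by split; apply: functional_extensionality_dep; [exact: invr | exact: invl].
  by apply: functional_extensionality_dep => s; apply: esym (ddual_nat _ _ _ _).
exists (fun A s => sval (inv A s)); split=> [A|A B f].
  exact: (@RepG_iso _ _ _ (ddual abL alpha A)).
apply: functional_extensionality_dep => s.
(* Insert the bidual comparison of [A] and its inverse, then use its naturality. *)
rewrite -[LHS](@rep_compm1 k L) -(invr A s) rep_compA.
rewrite -[X in rep_comp X _](@rep_compA k L) -[X in rep_comp (rep_comp _ X) _]ddual_nat.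
by rewrite [X in rep_comp X _]rep_compA invl rep_comp1m.
Qed.

Definition RepG_right_r : right_r_structure C :=
  RightRStructure RepG_dualP RepG_dual_equiv.

Lemma RepG_tensor_bilinear : tensor_bilinear RepG_tensor.
Proof.
move=> A A' B B' a; split=> [f f' g|f g g'];
  apply: functional_extensionality_dep => s.
- exact: gmap_linear_l.
exact: gmap_linear_r.
Qed.

Lemma RepG_dual_linear : dual_linear RepG_dual.
Proof.
move=> A B a f g; apply: functional_extensionality_dep => s.
exact: gdual_map_linear.
Qed.

Lemma RepG_tensor_homog (p q : Q) :
  nat_isomorphic
    (comp_functor RepG_tensor (prod_functor (homog k X p) (homog k X q)))
    (comp_functor (homog k X (p * q)%g)
      (comp_functor (rep_ten k X)
        (prod_functor (id_functor (RepCat k L)) (rep_twist k X p^-1%g)))).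
Proof.
exists (fun MN => conc_ten abL alpha p q MN.1 MN.2); split=> [MN|MN MN' f].
  exact: (RepG_iso (conc_tenK _ _ _ _ _ _) (conc_ten_invK _ _ _ _ _ _)).
by apply: functional_extensionality_dep => s; apply: conc_ten_nat.
Qed.

Lemma RepG_dual_homog (p : Q) :
  nat_isomorphic
    (comp_functor RepG_dual (op_functor (homog k X p)))
    (comp_functor (homog k X p^-1%g)
      (comp_functor (rep_dual k X) (op_functor (rep_twist k X p)))).
Proof.
pose inv (M : rep k L) q :=
  rep_iso_inv (conc_dual_inj abL alpha p M q) (dim_conc_dual abL alpha p M q).
have invl M q : rep_comp (sval (inv M q)) (conc_dual abL alpha p M q) = rep_id _.
  by case: (inv M q) => g [].
have invr M q : rep_comp (conc_dual abL alpha p M q) (sval (inv M q)) = rep_id _.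
  by case: (inv M q) => g [].
exists (fun M => conc_dual abL alpha p M); split=> [M|M N f].
  exact: (RepG_iso (invl M) (invr M)).
by apply: functional_extensionality_dep => s; apply: conc_dual_nat.
Qed.

End Assembly.

Theorem proposition5p27 (k : fieldType) (G H : finGroupType)
    (X : crossed_module G H) :
  exists R : right_r_structure (RepG k X),
    [/\ tensor_bilinear (tensor R),
        dual_linear (rr_dual R),
        (forall p q : cm_Q X,
           nat_isomorphic
             (comp_functor (tensor R) (prod_functor (homog k X p) (homog k X q)))
             (comp_functor (homog k X (p * q)%g)
               (comp_functor (rep_ten k X)
                 (prod_functor (id_functor (RepCat k (cm_L X)))
                               (rep_twist k X p^-1%g)))))
      & (forall p : cm_Q X,
           nat_isomorphic
             (comp_functor (rr_dual R) (op_functor (homog k X p)))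
             (comp_functor (homog k X p^-1%g)
               (comp_functor (rep_dual k X) (op_functor (rep_twist k X p)))))].
Proof.
exists (RepG_right_r k X); split.
- exact: RepG_tensor_bilinear.
- exact: RepG_dual_linear.
- exact: RepG_tensor_homog.
exact: RepG_dual_homog.
Qed.
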